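(* Let $\lambda$ be a plane partition of size $n$, and write the vertex function $|\tau\rangle_\lambda(z)$ of $\mathrm{Hilb}^n(\mathbb C^3)$ as the contour integral given in the context, an integral over variables $(s_\square)_{\square\in\lambda}$, also denoted $s_1,\dots,s_n$. Make the substitution $\overline z=z\,2\hbar$ (a normalization of the Kähler variable $z$). Then, at $\hbar\to0$, the saddle point equation of the integrand (the equation determining its critical points) is $$\overline{z}=\frac{1}{s_i}\prod_{a=1}^3\prod_{j\neq i}\frac{s_i-s_j-\hbar_a}{s_i-s_j+\hbar_a},\qquad i=1,\ldots,n.$$ Here $\hbar_1,\hbar_2,\hbar_3$ are the equivariant variables of the Calabi–Yau torus $F_0$, with $\hbar_1+\hbar_2+\hbar_3=0$.
   Context: Target and torus. $\mathrm{Hilb}^n(\mathbb C^3)=\mathrm{Crit}(\phi)/\!\!/GL_n$ with $\phi=\mathrm{tr}(b_1[b_2,b_3])$ on $W=V\oplus\mathrm{End}(V)^{\oplus3}$, $V=\mathbb C^n$, stability $\theta=\det$. The torus $F=(\mathbb C^* )^3$ with weights $t_1,t_2,t_3$ scales $b_1,b_2,b_3$; $F_0=\{t_1t_2t_3=1\}$; $\hbar_i=c_1(t_i)$. $\mathbb C^*_q$ acts on $\mathbb P^1$ fixing $0$ and $\infty$, $\hbar=-c_1(q)$, $T_0=F_0\times\mathbb C^*_q$. Fix integers $\sigma_1,\sigma_2,\sigma_3$ with $\sigma_1+\sigma_2+\sigma_3=2$ and $\mathcal L_i=\mathcal O_{\mathbb P^1}(-\sigma_i)$. Vertex function. The vertex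 function $|\tau\rangle_\lambda(z)=\sum_d|\tau\rangle^d_\lambda z^d$ with descendent insertion $\tau\in K_{GL_n\times T}(\mathrm{pt})$, $T=F\times\mathbb C^*_q$, is the generating series of $T_0$-equivariant virtual counts (by torus localization), with insertion $e^{T_0}(\tau(\mathcal V|_0))$, of degree $d$ twisted quasimaps from $\mathbb P^1$ to $\mathrm{Hilb}^n(\mathbb C^3)$: rank $n$, degree $d$ bundles $\mathcal V$ on $\mathbb P^1$ with a section of $\mathcal V\oplus\bigoplus_{i=1}^3\mathcal End(\mathcal V)\otimes\mathcal L_i$ landing in the critical locus of $\phi$, generically stable, stable at $\infty$, and with value at $\infty$ the torus fixed point $\lambda$ (a plane partition with boxes $\square=(i_1,i_2,i_3)\in\mathbb N^3$). Contour integral. Put $\Gamma_{2\hbar}(x):=\Gamma(x/2\hbar)$, $\langle\sigma,\square\rangle=\sum_ji_j\sigma_j$, $\hbar_\square=-\sum_ji_j\hbar_j$. Then $$|\tau\rangle_\lambda(z)=\int_{C}A_\lambda\prod_{\square\in\lambda}\tau(2\hbar_\square-s_\square)\,(z/2\hbar)^{\frac{s_\square-\hbar_\square-\langle\sigma,\square\rangle\hbar}{2\hbar}}\,\Gamma_{2\hbar}(s_\square)\prod_{\square,\square'\in\lambda}\frac{\prod_{i=1}^3\Gamma_{2\hbar}(s_\square-s_{\square'}+\hbar_i+\sigma_i\hbar)}{\Gamma_{2\hbar}(s_\square-s_{\square'})}\prod_{\square\in\lambda}ds_\square .$$ Here $\tau(\cdot)$ denotes the insertion evaluated at the indicated values of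 the Chern roots. The factor $A_\lambda$ is independent of the $s_\square$: $A_\lambda=A_2^\lambda\,\bar A_1^\lambda/A_1^\lambda$, where $$A_1^\lambda=\frac{\prod_{\square}\hbar_\square\prod_{a=1}^3\prod_{\square,\square'}(\hbar_\square-\hbar_{\square'}+\hbar_a)}{\prod_{\square,\square'}(\hbar_\square-\hbar_{\square'})},\qquad \bar A_1^\lambda=\frac{\prod_{\square}\hbar_\square\prod_{a=1}^3\prod_{\square,\square'}(\hbar_\square-\hbar_{\square'}+\hbar_a)}{\prod_{\square\neq\square'}(\hbar_\square-\hbar_{\square'})},$$ $$A_2^\lambda=\frac{\prod_{\square,\square'}\Gamma_{2\hbar}(\hbar_\square-\hbar_{\square'}+\langle\sigma,\square\rangle\hbar-\langle\sigma,\square'\rangle\hbar+2\hbar)}{\prod_{\square}\Gamma_{2\hbar}(\hbar_\square+\langle\sigma,\square\rangle\hbar+2\hbar)\prod_{i=1}^3\prod_{\square,\square'}\Gamma_{2\hbar}(\hbar_\square-\hbar_{\square'}+\langle\sigma,\square\rangle\hbar-\langle\sigma,\square'\rangle\hbar+\hbar_i-\sigma_i\hbar+2\hbar)}$$ (all products over boxes of $\lambda$; zero factors are kept as formal factors, and $A_1^\lambda$ is the equivariant Euler class of the virtual tangent space of $\mathrm{Hilb}^n(\mathbb C^3)$ at $\lambda$, which is well defined and nonzero). $C$ is a real $n$-cycle which in the $s_{(0,0,0)}$-plane encloses $s_{(0,0,0)}=-d(2\hbar)$ for all $d\in\mathbb N$ and, inductively, in the $s_{(i_1,i_2,i_3)}$-plane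 encloses $s_{(i_1+1,i_2,i_3)}-s_{(i_1,i_2,i_3)}+\sigma_1\hbar+\hbar_1=-d(2\hbar)$, $s_{(i_1,i_2+1,i_3)}-s_{(i_1,i_2,i_3)}+\sigma_2\hbar+\hbar_2=-d(2\hbar)$, $s_{(i_1,i_2,i_3+1)}-s_{(i_1,i_2,i_3)}+\sigma_3\hbar+\hbar_3=-d(2\hbar)$ for all $d\in\mathbb N$.
   Formalization: The substitution is corrected to z̄ = z/(2ħ)² instead of z̄ = z·2ħ, which fails already for n = 1; ħ→0 is taken along rays avoiding accumulating Gamma poles, at points s where the insertion has no zero or pole. *)

(* Defs.v *)
From Stdlib Require Import Reals ZArith Permutation ClassicalEpsilon.
From Coquelicot Require Import Coquelicot.
From mathcomp Require Import all_boot perm.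

Set Implicit Arguments.
Unset Strict Implicit.
Unset Printing Implicit Defensive.

(* MathComp reserves the key R for ring_scope. *)
Delimit Scope R_scope with Re.

(* ** Finite sums and products of complex numbers *)

Notation "\csum_ ( i 'in' T ) F" := (\big[Cplus/RtoC 0]_(i : T) F%C)
  (at level 41, F at level 41, i, T at level 50) : C_scope.
Notation "\cprod_ ( i 'in' T ) F" := (\big[Cmult/RtoC 1]_(i : T) F%C)
  (at level 36, F at level 36, i, T at level 50) : C_scope.
Notation "\cprod_ ( i 'in' T | P ) F" :=
  (\big[Cmult/RtoC 1]_(i : T | P%B) F%C)
  (at level 36, F at level 36, i, T at level 50) : C_scope.

Local Open Scope C_scope.

Definition ZtoC (k : Z) : C := RtoC (IZR k).

(* ** Complex exponential and Gamma function *)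

Definition Cexp (z : C) : C :=
  (RtoC (exp (Re z)) * (cos (Im z), sin (Im z))%Re)%C.

(* Gauss' product: Gamma(x) = lim_m m! m^x / (x (x+1) ... (x+m)), valid for
   every x in C outside {0, -1, -2, ...}. *)
Definition Gamma_approx (x : C) (m : nat) : C :=
  RtoC (INR (fact m)) * Cexp (x * RtoC (ln (INR m)))
    / \cprod_(k in 'I_m.+1) (x + RtoC (INR k)).

Definition Gamma (x : C) : C :=
  (real (Lim_seq (fun m => Re (Gamma_approx x m))),
   real (Lim_seq (fun m => Im (Gamma_approx x m)))).

Definition Gamma_pole (x : C) : Prop := exists m : nat, x = - RtoC (INR m).

(* ** Formal zero factors
   On the Calabi-Yau torus some factors of the integrand vanish identically
   (e.g. hbar_(0,0,0) and 1/Gamma(s_b - s_b)).  Such a factor is kept as a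
   formal symbol [eps]; a Gamma factor sitting at a pole is kept as [/ eps].
   Statements are made for every nonzero value of [eps]. *)

Definition fac (eps x : C) : C := if Ceq_dec x 0 then eps else x.

Definition GammaF (eps x : C) : C :=
  if excluded_middle_informative (Gamma_pole x) then / eps else Gamma x.

Definition Gamma2 (eps hb x : C) : C := GammaF eps (x / (RtoC 2 * hb)).

(* ** Plane partitions *)

Definition box := 3.-tuple nat.

(* A plane partition of size n, with a numbering of its boxes. *)
Definition is_plane_partition n (lam : n.-tuple box) : Prop :=
  uniq lam /\
  forall b c : box, c \in lam ->
    (forall a : 'I_3, (tnth b a <= tnth c a)%N) -> b \in lam.

(* <sigma, box> *)
Definition sigma_box (sigma : 'I_3 -> Z) (b : box) : C :=
  \csum_(a in 'I_3) (RtoC (INR (tnth b a)) * ZtoC (sigma a)).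

(* hbar_box *)
Definition h_box (h : 'I_3 -> C) (b : box) : C :=
  - \csum_(a in 'I_3) (RtoC (INR (tnth b a)) * h a).

(* ** Descendent insertions: classes in K_{GL_n x T}(pt), T = F x C^*_q *)

(* A character of (maximal torus of GL_n) x F x C^*_q. *)
Record weight n := Weight {
  wt_root : {ffun 'I_n -> Z};
  wt_F : {ffun 'I_3 -> Z};
  wt_q : Z }.

Definition wt_perm n (p : {perm 'I_n}) (w : weight n) : weight n :=
  Weight [ffun i => wt_root w (p i)] (wt_F w) (wt_q w).

(* First Chern class of a character; recall that c_1(q) = - hbar. *)
Definition wt_c1 n (h : 'I_3 -> C) (hb : C) (x : 'I_n -> C) (w : weight n) : C :=
  \csum_(i in 'I_n) (ZtoC (wt_root w i) * x i)
  + \csum_(a in 'I_3) (ZtoC (wt_F w a) * h a)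
  + ZtoC (wt_q w) * (- hb).

(* A difference of two representations, each given by its weights, which are
   invariant under the Weyl group S_n. *)
Record Kclass n := KClass {
  K_pos : list (weight n);
  K_neg : list (weight n);
  K_posW : forall p, Permutation (List.map (wt_perm p) K_pos) K_pos;
  K_negW : forall p, Permutation (List.map (wt_perm p) K_neg) K_neg }.

(* Equivariant Euler class at the Chern roots x. *)
Definition K_euler n (h : 'I_3 -> C) (hb : C) (tau : Kclass n) (x : 'I_n -> C) : C :=
  List.fold_right Cmult (RtoC 1) (List.map (wt_c1 h hb x) (K_pos tau))
  / List.fold_right Cmult (RtoC 1) (List.map (wt_c1 h hb x) (K_neg tau)).

Definition chern_roots n (lam : n.-tuple box) (h : 'I_3 -> C) (s : 'I_n -> C)
    : 'I_n -> C :=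
  fun i => RtoC 2 * h_box h (tnth lam i) - s i.

(* ** The prefactor A_lambda *)

Section Prefactor.
Variables (n : nat) (lam : n.-tuple box) (sigma : 'I_3 -> Z) (h : 'I_3 -> C).
Variables (eps hb : C).

Let H (i : 'I_n) : C := h_box h (tnth lam i).
Let S (i : 'I_n) : C := sigma_box sigma (tnth lam i) * hb.

Definition A1_lambda_num : C :=
  (\cprod_(i in 'I_n) fac eps (H i))
  * (\cprod_(a in 'I_3) \cprod_(i in 'I_n) \cprod_(j in 'I_n)
       fac eps (H i - H j + h a)).

Definition A1_lambda : C :=
  A1_lambda_num / \cprod_(i in 'I_n) \cprod_(j in 'I_n) fac eps (H i - H j).

Definition A1bar_lambda : C :=
  A1_lambda_num / \cprod_(i in 'I_n) \cprod_(j in 'I_n | i != j) fac eps (H i - H j).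

Definition A2_lambda : C :=
  (\cprod_(i in 'I_n) \cprod_(j in 'I_n)
     Gamma2 eps hb (H i - H j + S i - S j + RtoC 2 * hb))
  / ((\cprod_(i in 'I_n) Gamma2 eps hb (H i + S i + RtoC 2 * hb))
     * (\cprod_(a in 'I_3) \cprod_(i in 'I_n) \cprod_(j in 'I_n)
          Gamma2 eps hb (H i - H j + S i - S j
                         + h a - ZtoC (sigma a) * hb + RtoC 2 * hb))).

End Prefactor.

Definition A_lambda n (lam : n.-tuple box) (sigma : 'I_3 -> Z) (h : 'I_3 -> C)
    (eps hb : C) : C :=
  A2_lambda lam sigma h eps hb * A1bar_lambda lam h eps / A1_lambda lam h eps.

(* ** The integrand
   The i-th power of z/2hbar is taken with respect to its own value [L i] of
   log (z/2hbar). *)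

Definition integrand n (lam : n.-tuple box) (sigma : 'I_3 -> Z) (h : 'I_3 -> C)
    (tau : Kclass n) (eps hb : C) (L : 'I_n -> C) (s : 'I_n -> C) : C :=
  A_lambda lam sigma h eps hb
  * K_euler h hb tau (chern_roots lam h s)
  * (\cprod_(i in 'I_n)
       (Cexp ((s i - h_box h (tnth lam i) - sigma_box sigma (tnth lam i) * hb)
              / (RtoC 2 * hb) * L i)
        * Gamma2 eps hb (s i)))
  * (\cprod_(i in 'I_n) \cprod_(j in 'I_n)
       ((\cprod_(a in 'I_3) Gamma2 eps hb (s i - s j + h a + ZtoC (sigma a) * hb))
        / Gamma2 eps hb (s i - s j))).

(* ** Saddle points at hbar -> 0 *)

Definition upd n (s : 'I_n -> C) (i : 'I_n) (x : C) : 'I_n -> C :=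
  fun j => if j == i then x else s j.

(* hbar tends to 0 along the ray e * u, e -> 0+ (the Gamma factors have no
   limiting behaviour along rays on which their poles accumulate).  The
   integrand behaves as exp (S(s) / 2hbar); its critical points at hbar -> 0
   are those of S, i.e. the s at which
   2hbar * d/ds_i log (integrand) -> 0 for every i,
   for some choice of continuous branches of the powers of z/2hbar.
   The Kaehler variable z is rescaled with hbar: d/ds log Gamma (s/2hbar)
   contributes log (s/2hbar), so that besides the factor 1/2hbar of z/2hbar a
   second one appears and z / (2hbar)^2 is to be kept fixed. *)
Definition saddle_point n (lam : n.-tuple box) (sigma : 'I_3 -> Z)
    (h : 'I_3 -> C) (tau : Kclass n) (eps : C) (z : C -> C) (u : C)
    (s : 'I_n -> C) : Prop :=
  exists L : R -> 'I_n -> C,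
    (forall i (e : R), (0 < e)%Re ->
       continuous (fun e' => L e' i) e /\
       Cexp (L e i) = z (RtoC e * u) / (RtoC 2 * (RtoC e * u))) /\
    (forall i, exists D : R -> C,
       at_right 0%Re (fun e =>
         let I := integrand lam sigma h tau eps (RtoC e * u) (L e) in
         I s <> RtoC 0 /\
         @is_derive C_AbsRing C_NormedModule (fun x => I (upd s i x)) (s i) (D e)) /\
       filterlim (fun e =>
           RtoC 2 * (RtoC e * u) * D e
           / integrand lam sigma h tau eps (RtoC e * u) (L e) s)
         (at_right 0%Re) (locally (RtoC 0))).

(* ** Generic points *)

(* x / u does not lie on the half-line (-oo, 0] *)
Definition off_cut (u x : C) : Prop :=
  forall r : R, (0 <= r)%Re -> x <> - (RtoC r * u).

(* No weight of tau vanishes identically in hbar, and those involving the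
   Chern roots stay away from 0 as hbar -> 0. *)
Definition insertion_regular n (lam : n.-tuple box) (h : 'I_3 -> C)
    (tau : Kclass n) (s : 'I_n -> C) : Prop :=
  forall w, List.In w (K_pos tau) \/ List.In w (K_neg tau) ->
    (exists hb, wt_c1 h hb (chern_roots lam h s) w <> RtoC 0) /\
    ((exists i, wt_root w i <> 0%Z) ->
       wt_c1 h (RtoC 0) (chern_roots lam h s) w <> RtoC 0).

Definition regular_point n (lam : n.-tuple box) (h : 'I_3 -> C)
    (tau : Kclass n) (u : C) (s : 'I_n -> C) : Prop :=
  (forall i, off_cut u (s i)) /\
  (forall i j, i != j -> off_cut u (s i - s j)) /\
  (forall (a : 'I_3) i j, i != j -> off_cut u (s i - s j + h a)) /\
  insertion_regular lam h tau s.

(* Main.v *)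
(* Gauss' product gives d/dx log Gamma(x) = digamma(x), and the Euler-Maclaurin comparison of
   sum 1/(x+k) with the logarithm gives digamma(w/2e + c) + log 2e -> Log w as e -> 0+, for w off
   the half-line (-oo, 0].  Hence 2 hbar d/ds_i log of the integrand is
   L_i - log 2e + Log(s_i/u) + sum over j of differences of logarithms, up to o(1): the terms log 2e
   of all Gamma factors but Gamma(s_i) cancel in pairs, the prefactor does not depend on s, and the
   insertion contributes O(hbar).  Exponentiating and using exp L_i = 2 hbar zbar yields the Bethe
   equation; conversely the equation lets one take L_i - log 2e constant. *)
Require Import Defs.
From HB Require Import structures.
From Stdlib Require Import Reals ZArith Lra Lia ClassicalEpsilon FunctionalExtensionality.
From Coquelicot Require Import Coquelicot.
From mathcomp Require Import all_boot perm.

Set Implicit Arguments.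
Unset Strict Implicit.
Unset Printing Implicit Defensive.

Local Open Scope R_scope.
Local Open Scope C_scope.

(** Gauss' product is never differentiated as a limit of holomorphic functions, so no locally
    uniform convergence enters. Two points are compared factor by factor instead: (x+k)/(x0+k) is
    written as an exponential, its first-order part is split off, and the remainder is of size
    |x-x0|^2/k^2 with an explicit constant. With x0 = 1, where the product is elementary, this
    yields convergence and nonvanishing of Gamma; with x0 close to x it yields differentiability
    with a quadratic error. All these series, and the one for digamma(x) - Log x, are dominated by
    one telescoping majorant with a free parameter r. A second obstacle is that the logarithmic
    derivatives of single factors diverge like log 2e and that logarithms depend on branches. Hence
    a logarithmic derivative is recorded only up to o(1), relative to a comparison function that may
    diverge, and logarithms are turned into equations only through [Cexp]. Factors of a pair (i, i)
    do not move with s and may sit at a pole; for them a nonzero [eps] suffices. *)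

HB.instance Definition _ :=
  Monoid.isComLaw.Build C (RtoC 0) Cplus Cplus_assoc Cplus_comm Cplus_0_l.
HB.instance Definition _ :=
  Monoid.isComLaw.Build C (RtoC 1) Cmult Cmult_assoc Cmult_comm Cmult_1_l.

(** * Limits and derivatives in [C] *)

Lemma im_le_Cmod (z : C) : (Rabs (Im z) <= Cmod z)%Re.
Proof. exact: Rle_trans (Rmax_r _ _) (Rmax_Cmod z). Qed.

Lemma Cmod_le_parts (z : C) : (Cmod z <= Rabs (Re z) + Rabs (Im z))%Re.
Proof.
have -> : z = RtoC (Re z) + Ci * RtoC (Im z) by case: z => a b; rewrite /RtoC /Ci /Cmult /Cplus /=; f_equal; ring.
apply: Rle_trans (Cmod_triangle _ _) _.
rewrite Cmod_mult Cmod_Ci !Cmod_R !re_plus !im_plus ?re_mult ?im_mult /=; apply: Req_le.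
rewrite Rmult_1_l; f_equal; f_equal; ring.
Qed.

(** Balls of [C] are products of balls of the coordinates, so they agree with discs only up to a
    factor sqrt 2; halving the radius absorbs it. *)
Lemma filterlim_C (T : Type) (F : (T -> Prop) -> Prop) {FF : Filter F}
    (f : T -> C) (l : C) :
  filterlim f F (locally l) <->
  (forall eps : R, (0 < eps)%Re -> F (fun x => (Cmod (f x - l) < eps)%Re)).
Proof.
split.
- move=> H eps He.
  have He2 : (0 < eps / 2)%Re by lra.
  move/filterlim_locally: H => /(_ (mkposreal _ He2)).
  apply: filter_imp => x /C_NormedModule_mixin_compat2 /= Hx.
  apply: Rlt_le_trans Hx _.
  have : (sqrt 2 <= 2)%Re by rewrite -{2}(sqrt_square 2); [apply: sqrt_le_1; lra | lra].
  by nra.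
- move=> H; apply/filterlim_locally => eps.
  apply: filter_imp (H eps (cond_pos eps)) => x Hx.
  exact: C_NormedModule_mixin_compat1.
Qed.

(** [C] carries two uniform structures, the product one and that of its absolute value. They have
    the same neighbourhoods; continuity of multiplication is available for the second. *)
Lemma filterlim_AbsRing_C (T : Type) (F : (T -> Prop) -> Prop) (f : T -> C) (l : C) :
  filterlim f F (@locally C_UniformSpace l) <->
  filterlim f F (@locally (AbsRing_UniformSpace C_AbsRing) l).
Proof. by split=> H P /locally_C HP; exact: H. Qed.

Section LimC.
Variables (T : Type) (F : (T -> Prop) -> Prop).
Context {FF : Filter F}.
Implicit Types f g : T -> C.

Lemma filterlim_C_eq f g a b :
  filterlim f F (locally a) -> a = b -> F (fun x => f x = g x) ->
  filterlim g F (locally b).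
Proof. by move=> Hf <- E; exact: filterlim_ext_loc E Hf. Qed.

Lemma filterlim_Cplus f g a b :
  filterlim f F (locally a) -> filterlim g F (locally b) ->
  filterlim (fun x => f x + g x) F (locally (a + b)).
Proof.
move=> Hf Hg.
exact: (@filterlim_comp_2 _ _ _ _ F _ _ _ FF f g Cplus Hf Hg (@filterlim_plus C_AbsRing C_NormedModule a b)).
Qed.

Lemma filterlim_Cmult f g a b :
  filterlim f F (locally a) -> filterlim g F (locally b) ->
  filterlim (fun x => f x * g x) F (locally (a * b)).
Proof.
move=> /filterlim_AbsRing_C Hf /filterlim_AbsRing_C Hg; apply/filterlim_AbsRing_C.
exact: (@filterlim_comp_2 _ _ _ _ F _ _ _ FF f g Cmult Hf Hg (@filterlim_mult C_AbsRing a b)).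
Qed.

Lemma filterlim_Copp f a :
  filterlim f F (locally a) -> filterlim (fun x => - f x) F (locally (- a)).
Proof.
move=> Hf; apply: filterlim_comp Hf _.
exact: (@filterlim_opp C_AbsRing C_NormedModule a).
Qed.

Lemma filterlim_Cminus f g a b :
  filterlim f F (locally a) -> filterlim g F (locally b) ->
  filterlim (fun x => f x - g x) F (locally (a - b)).
Proof. by move=> Hf /filterlim_Copp; apply: filterlim_Cplus. Qed.

Lemma filterlim_Cinv f a : a <> RtoC 0 ->
  filterlim f F (locally a) -> filterlim (fun x => / f x) F (locally (/ a)).
Proof.
move=> Ha /filterlim_C Hf; apply/filterlim_C => eps He.
have Ha' := proj1 (Cmod_gt_0 a) Ha.
(* The first bound keeps |f x| above |a|/2, the second then makes |f x - a| / (|f x| |a|) smaller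
   than [eps]. *)
set d := Rmin (Cmod a / 2) (eps * (Cmod a * Cmod a) / 2).
have Hd : (0 < d)%Re.
  apply: Rmin_glb_lt; first lra.
  by have := Rmult_lt_0_compat _ _ He (Rmult_lt_0_compat _ _ Ha' Ha'); lra.
apply: filter_imp (Hf d Hd) => x Hx.
have H1 : (Cmod (f x - a) < Cmod a / 2)%Re by apply: Rlt_le_trans Hx (Rmin_l _ _).
have H2 : (Cmod (f x - a) < eps * (Cmod a * Cmod a) / 2)%Re
  by apply: Rlt_le_trans Hx (Rmin_r _ _).
have H3 : (Cmod a / 2 < Cmod (f x))%Re.
  have := Cmod_triangle (f x) (- (f x - a)).
  have -> : f x + - (f x - a) = a by ring.
  rewrite Cmod_opp; lra.
have Hfx : f x <> RtoC 0 by apply/Cmod_gt_0; lra.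
have -> : / f x - / a = - (f x - a) / (f x * a) by field.
rewrite Cmod_div; last exact: Cmult_neq_0.
rewrite Cmod_opp Cmod_mult.
apply: (Rmult_lt_reg_r (Cmod (f x) * Cmod a)); first by apply: Rmult_lt_0_compat; lra.
rewrite /Rdiv Rmult_assoc Rinv_l; last by apply: Rgt_not_eq; apply: Rmult_lt_0_compat; lra.
rewrite Rmult_1_r; apply: Rlt_le_trans H2 _.
have : (eps * (Cmod a / 2 * Cmod a) <= eps * (Cmod (f x) * Cmod a))%Re.
  apply: Rmult_le_compat_l; first lra.
  apply: Rmult_le_compat_r; lra.
lra.
Qed.

Lemma filterlim_RtoC (f : T -> R) a :
  filterlim f F (locally a) -> filterlim (fun x => RtoC (f x)) F (locally (RtoC a)).
Proof.
move=> Hf; apply/filterlim_C => eps He.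
move/filterlim_locally: Hf => /(_ (mkposreal _ He)); apply: filter_imp => x Hx.
by rewrite -RtoC_minus Cmod_R; exact: Hx.
Qed.

Lemma filterlim_C_bound f a (b : T -> R) :
  F (fun x => (Cmod (f x - a) <= b x)%Re) -> filterlim b F (locally 0%Re) ->
  filterlim f F (locally a).
Proof.
move=> Hb H0; apply/filterlim_C => eps He.
move/filterlim_locally: H0 => /(_ (mkposreal _ He)) H.
apply: filter_imp (filter_and _ _ Hb H) => x [H1 H2].
apply: Rle_lt_trans H1 _; apply: Rle_lt_trans (Rle_abs _) _.
by have := H2; rewrite /ball /= /AbsRing_ball /abs /minus /plus /opp /= Ropp_0 Rplus_0_r.
Qed.

Lemma filterlim_Re f a :
  filterlim f F (locally a) -> filterlim (fun x => Re (f x)) F (locally (Re a)).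
Proof.
move=> /filterlim_C Hf; apply/filterlim_locally => eps.
apply: filter_imp (Hf _ (cond_pos eps)) => x Hx.
exact: Rle_lt_trans (re_le_Cmod (f x - a)) Hx.
Qed.

Lemma filterlim_Im f a :
  filterlim f F (locally a) -> filterlim (fun x => Im (f x)) F (locally (Im a)).
Proof.
move=> /filterlim_C Hf; apply/filterlim_locally => eps.
apply: filter_imp (Hf _ (cond_pos eps)) => x Hx.
exact: Rle_lt_trans (im_le_Cmod (f x - a)) Hx.
Qed.

Lemma filterlim_C_unique f a b {PF : ProperFilter' F} :
  filterlim f F (locally a) -> filterlim f F (locally b) -> a = b.
Proof. exact: (@filterlim_locally_unique T C_AbsRing C_NormedModule F PF f a b). Qed.

Lemma Cmod_lim_le f a B {PF : ProperFilter F} :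
  filterlim f F (locally a) -> F (fun x => (Cmod (f x) <= B)%Re) -> (Cmod a <= B)%Re.
Proof.
move=> /filterlim_C Hf HB; apply: Rnot_lt_le => Hlt.
have He : (0 < Cmod a - B)%Re by lra.
have [x [H1 H2]] := filter_ex _ (filter_and _ _ HB (Hf _ He)).
have := Cmod_triangle (f x) (- (f x - a)).
have -> : f x + - (f x - a) = a by ring.
rewrite Cmod_opp; lra.
Qed.

End LimC.

Lemma is_C_derive_AbsRing (f : C -> C) (x l : C) :
  @is_derive C_AbsRing C_NormedModule f x l <->
  @is_derive C_AbsRing (AbsRing_NormedModule C_AbsRing) f x l.
Proof. by split=> [] [[H1 H2 H3] H4]; split. Qed.

Lemma is_C_derive_spec (f : C -> C) (x l : C) :
  @is_derive C_AbsRing C_NormedModule f x l <->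
  (forall eps : R, (0 < eps)%Re -> exists d : R, (0 < d)%Re /\
     forall y, (Cmod (y - x) < d)%Re ->
       (Cmod (f y - f x - (y - x) * l) <= eps * Cmod (y - x))%Re).
Proof.
split.
- move=> [_ H] eps He.
  have Hx : is_filter_lim (locally (x : AbsRing_NormedModule C_AbsRing)) x by [].
  have [d Hd] := H x Hx (mkposreal _ He).
  by exists d; split; [exact: cond_pos | move=> y Hy; exact: Hd].
- move=> H; split; first exact: (@is_linear_scal_l C_AbsRing C_NormedModule l).
  move=> x' Hx' eps.
  have <- : x = x' := @is_filter_lim_locally_unique C_AbsRing (AbsRing_NormedModule C_AbsRing) x x' Hx'.
  have [d [Hd Hy]] := H eps (cond_pos eps).
  by exists (mkposreal _ Hd) => y /= Hyd; exact: Hy.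
Qed.

Lemma is_C_derive_mult (f g : C -> C) (x l m : C) :
  @is_derive C_AbsRing C_NormedModule f x l ->
  @is_derive C_AbsRing C_NormedModule g x m ->
  @is_derive C_AbsRing C_NormedModule (fun y => f y * g y) x (l * g x + f x * m).
Proof.
move=> /is_C_derive_AbsRing Hf /is_C_derive_AbsRing Hg; apply/is_C_derive_AbsRing.
exact (@is_derive_mult C_AbsRing f g x l m Hf Hg Cmult_comm).
Qed.

Lemma is_C_derive_comp (f g : C -> C) (x l m : C) :
  @is_derive C_AbsRing C_NormedModule f (g x) l ->
  @is_derive C_AbsRing C_NormedModule g x m ->
  @is_derive C_AbsRing C_NormedModule (fun y => f (g y)) x (m * l).
Proof. by move=> Hf /is_C_derive_AbsRing Hg; exact (@is_derive_comp C_AbsRing C_NormedModule f g x l m Hf Hg). Qed.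

Lemma is_C_derive_inv (x : C) : x <> RtoC 0 ->
  @is_derive C_AbsRing C_NormedModule Cinv x (- / (x * x)).
Proof.
move=> Hx; apply/is_C_derive_spec => eps He.
have Hx' := proj1 (Cmod_gt_0 x) Hx.
have Hx2 : (0 < Cmod x * (Cmod x * Cmod x))%Re by apply: Rmult_lt_0_compat => //; nra.
set d := Rmin (Cmod x / 2) (eps * (Cmod x * (Cmod x * Cmod x)) / 2).
exists d; split.
  by apply: Rmin_glb_lt; [lra | have := Rmult_lt_0_compat _ _ He Hx2; lra].
move=> y Hy.
have H1 : (Cmod (y - x) < Cmod x / 2)%Re by apply: Rlt_le_trans Hy (Rmin_l _ _).
have H2 : (Cmod (y - x) < eps * (Cmod x * (Cmod x * Cmod x)) / 2)%Re
  by apply: Rlt_le_trans Hy (Rmin_r _ _).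
have H3 : (Cmod x / 2 < Cmod y)%Re.
  have := Cmod_triangle y (- (y - x)).
  have -> : y + - (y - x) = x by ring.
  rewrite Cmod_opp; lra.
have Hy0 : y <> RtoC 0 by apply/Cmod_gt_0; lra.
have -> : / y - / x - (y - x) * - / (x * x) = (y - x) * (y - x) / (y * (x * x)) by field.
rewrite Cmod_div; last by apply: Cmult_neq_0 => //; apply: Cmult_neq_0.
rewrite !Cmod_mult.
apply: (Rmult_le_reg_r (Cmod y * (Cmod x * Cmod x))); first by apply: Rmult_lt_0_compat; nra.
rewrite /Rdiv Rmult_assoc Rinv_l; last by apply: Rgt_not_eq; apply: Rmult_lt_0_compat; nra.
have := Cmod_ge_0 (y - x) => H0.
rewrite Rmult_1_r (Rmult_comm eps) Rmult_assoc.
apply: Rmult_le_compat_l => //.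
have : (Cmod x / 2 * (Cmod x * Cmod x) <= Cmod y * (Cmod x * Cmod x))%Re.
  by apply: Rmult_le_compat_r; [nra | lra].
nra.
Qed.

Lemma is_C_derive_affine (a b x : C) :
  @is_derive C_AbsRing C_NormedModule (fun y => a * y + b) x a.
Proof.
apply/is_C_derive_spec => eps He; exists 1%Re; split; first lra.
move=> y _; have -> : a * y + b - (a * x + b) - (y - x) * a = RtoC 0 by ring.
rewrite Cmod_0; have := Cmod_ge_0 (y - x); nra.
Qed.

Lemma is_C_derive_unique' (f : C -> C) (x l m : C) :
  @is_derive C_AbsRing C_NormedModule f x l ->
  @is_derive C_AbsRing C_NormedModule f x m -> l = m.
Proof. by move=> /is_C_derive_unique <- /is_C_derive_unique <-. Qed.

(** * The complex exponential *)

Lemma Cexp_add (z w : C) : Cexp (z + w) = Cexp z * Cexp w.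
Proof.
case: z w => [a b] [c d]; rewrite /Cexp /Cmult /RtoC /=.
by rewrite exp_plus cos_plus sin_plus; f_equal; ring.
Qed.

Lemma Cexp_0 : Cexp (RtoC 0) = RtoC 1.
Proof. by rewrite /Cexp /= exp_0 cos_0 sin_0 /Cmult /RtoC /=; f_equal; ring. Qed.

Lemma Cexp_neq_0 (z : C) : Cexp z <> RtoC 0.
Proof.
move=> H; have := Cexp_add z (- z).
rewrite H Cmult_0_l Cplus_opp_r Cexp_0; exact: C1_nz.
Qed.

Lemma Cexp_opp (z : C) : Cexp (- z) = / Cexp z.
Proof.
have H := Cexp_add z (- z); rewrite Cplus_opp_r Cexp_0 in H.
have Hz := @Cexp_neq_0 z.
by rewrite -[RHS]Cmult_1_r H Cmult_assoc Cinv_l // Cmult_1_l.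
Qed.

Lemma Cexp_R (r : R) : Cexp (RtoC r) = RtoC (exp r).
Proof. by rewrite /Cexp /= cos_0 sin_0 /Cmult /RtoC /=; f_equal; ring. Qed.

Lemma Rabs_sin_le (x : R) : (Rabs (sin x) <= Rabs x)%Re.
Proof.
have [c [H _]] := @MVT_cor4 sin cos 0%Re (Rabs x)
  (fun c _ => proj2 (is_derive_Reals _ _ _) (derivable_pt_lim_sin c)) x ltac:(by rewrite Rminus_0_r; apply: Rle_refl).
move: H; rewrite sin_0 !Rminus_0_r => ->.
rewrite Rabs_mult; have := COS_bound c; have := Rabs_pos x => H0 H1.
have : (Rabs (cos c) <= 1)%Re by apply: Rabs_le; lra.
nra.
Qed.

Lemma cos_lower (x : R) : (1 - cos x <= x * x / 2)%Re.
Proof.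
have -> : x = (2 * (x / 2))%Re by field.
rewrite cos_2a_sin.
have := Rabs_sin_le (x / 2) => /Rsqr_le_abs_1; rewrite /Rsqr; lra.
Qed.

Lemma sin_sub_bound (x : R) : (Rabs x <= 1 -> Rabs (sin x - x) <= x * x)%Re.
Proof.
move=> Hx.
have [c [H Hc]] := @MVT_cor4 (fun t => sin t - t)%Re (fun t => cos t - 1)%Re 0%Re (Rabs x)
  ltac:(move=> c _; auto_derive => //; ring) x ltac:(by rewrite Rminus_0_r; apply: Rle_refl).
move: H Hc; rewrite sin_0 !Rminus_0_r => -> Hc.
rewrite Rabs_mult.
have H1 : (Rabs (cos c - 1) <= c * c / 2)%Re.
  by rewrite Rabs_minus_sym Rabs_pos_eq; [exact: cos_lower | have := COS_bound c; lra].
have := Rabs_pos x; have := Rabs_pos c => Hc0 Hx0.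
have E : forall t : R, (t * t = Rabs t * Rabs t)%Re by move=> t; rewrite -Rabs_mult Rabs_pos_eq //; nra.
rewrite (E x); rewrite (E c) in H1.
apply: Rle_trans (Rmult_le_compat_r _ _ _ Hx0 H1) _.
nra.
Qed.

(** Multiplying 1 - a <= exp (-a) by exp a gives exp a <= 1/(1-a) = 1 + a + a^2/(1-a), and 1 - a >=
    1/2. *)
Lemma exp_sub_bound (a : R) : (Rabs a <= 1 / 2 -> 0 <= exp a - 1 - a <= 2 * (a * a))%Re.
Proof.
move=> /Rabs_le_between Ha; have := exp_ineq1_le a; have := exp_ineq1_le (- a) => H1 H2.
split; first lra.
have E : (exp a * exp (- a) = 1)%Re by rewrite -exp_plus Rplus_opp_r exp_0.
have := exp_pos a => Hp.
have H3 : (exp a * (1 - a) <= 1)%Re by nra.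
nra.
Qed.

(** Real and imaginary parts are each bounded by 3 |w|^2; the constant 10 is not sharp. An explicit
    quadratic remainder is needed again for the derivative of [Gamma]. *)
Lemma Cexp_sub_bound (w : C) : (Cmod w <= 1 / 2)%Re ->
  (Cmod (Cexp w - RtoC 1 - w) <= 10 * (Cmod w * Cmod w))%Re.
Proof.
move=> Hw; apply: Rle_trans (Cmod_le_parts _) _.
have Ha0 := re_le_Cmod w; have Hb0 := im_le_Cmod w.
case: w Hw Ha0 Hb0 => a b; set r := Cmod _ => Hw /= Ha Hb.
have Ha2 : (Rabs a <= 1 / 2)%Re by lra.
have Hb1 : (Rabs b <= 1)%Re by lra.
have He := exp_sub_bound Ha2; have Hc := cos_lower b; have Hs := sin_sub_bound Hb1.
have Hs' := Rabs_sin_le b; have Hc' := COS_bound b; have Hp := exp_pos a.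
have -> : (exp a * cos b - 0 * sin b + - (1) + - a = (exp a - 1 - a) - exp a * (1 - cos b))%Re by ring.
have -> : (exp a * sin b + 0 * cos b + - 0 + - b = (exp a - 1) * sin b + (sin b - b))%Re by ring.
have E : forall t : R, (t * t = Rabs t * Rabs t)%Re by move=> t; rewrite -Rabs_mult Rabs_pos_eq //; nra.
have Haa : (a * a <= r * r)%Re by rewrite E; have := Rabs_pos a; nra.
have Hbb : (b * b <= r * r)%Re by rewrite E; have := Rabs_pos b; nra.
have Hexp : (exp a <= 2)%Re by move/Rabs_le_between: Ha2; nra.
have H1 : (Rabs ((exp a - 1 - a) - exp a * (1 - cos b)) <= 3 * (r * r))%Re.
  apply: Rabs_le.
  have : (0 <= exp a * (1 - cos b) <= r * r)%Re by split; nra.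
  lra.
have H2 : (Rabs ((exp a - 1) * sin b) <= 2 * (r * r))%Re.
  rewrite Rabs_mult.
  have H3 : (Rabs (exp a - 1) <= 2 * r)%Re.
    apply: Rabs_le; move/Rabs_le_between: Ha2 => Ha2; move/Rabs_le_between: Ha => Ha; nra.
  have := Rabs_pos (exp a - 1); have := Rabs_pos (sin b); nra.
have := Rabs_triang ((exp a - 1) * sin b) (sin b - b); nra.
Qed.

Lemma is_C_derive_Cexp (x : C) : @is_derive C_AbsRing C_NormedModule Cexp x (Cexp x).
Proof.
apply/is_C_derive_spec => eps He.
have Hx := proj1 (Cmod_gt_0 _) (@Cexp_neq_0 x).
exists (Rmin (1 / 2) (eps / (10 * Cmod (Cexp x)))); split.
  by apply: Rmin_glb_lt; [lra | apply: Rdiv_lt_0_compat; lra].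
move=> y Hy.
have H1 : (Cmod (y - x) <= 1 / 2)%Re by apply: Rlt_le; apply: Rlt_le_trans Hy (Rmin_l _ _).
have H2 : (Cmod (y - x) < eps / (10 * Cmod (Cexp x)))%Re by apply: Rlt_le_trans Hy (Rmin_r _ _).
have -> : Cexp y - Cexp x - (y - x) * Cexp x = Cexp x * (Cexp (y - x) - RtoC 1 - (y - x)).
  have {1}-> : y = x + (y - x) by ring.
  by rewrite Cexp_add; ring.
rewrite Cmod_mult.
apply: Rle_trans (Rmult_le_compat_l _ _ _ (Rlt_le _ _ Hx) (Cexp_sub_bound H1)) _.
have := Cmod_ge_0 (y - x) => H0.
have H3 : (10 * Cmod (Cexp x) * Cmod (y - x) <= eps)%Re.
  apply: (Rmult_le_reg_r (/ (10 * Cmod (Cexp x)))); first by apply: Rinv_0_lt_compat; lra.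
  rewrite Rmult_comm -Rmult_assoc Rinv_l ?Rmult_1_l; lra.
nra.
Qed.

Lemma filterlim_Cexp (T : Type) (F : (T -> Prop) -> Prop) {FF : Filter F}
    (f : T -> C) (a : C) :
  filterlim f F (locally a) -> filterlim (fun x => Cexp (f x)) F (locally (Cexp a)).
Proof.
move=> Hf; apply: filterlim_comp Hf _ => P HP.
have Hc := @ex_derive_continuous C_AbsRing C_NormedModule Cexp a
  (ex_intro _ _ (is_C_derive_Cexp a)).
by apply/locally_C; exact: Hc.
Qed.

(** * The principal logarithm *)

(* Half-angle formula for the argument, valid off the half-line (-oo, 0]. *)
Definition Clog (z : C) : C :=
  (ln (Cmod z), 2 * atan (Im z / (Cmod z + Re z)))%Re.

(** The complement of the half-line (-oo, 0], written as positivity of the denominator in [Clog]. *)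
Definition slit (z : C) : Prop := (0 < Cmod z + Re z)%Re.

Lemma Cmod_sqr (z : C) : (Cmod z * Cmod z = Re z * Re z + Im z * Im z)%Re.
Proof. have := Cmod2_alt z; rewrite /= !Rmult_1_r => <-; ring. Qed.

Lemma slit_neq_0 z : slit z -> (0 < Cmod z)%Re.
Proof.
rewrite /slit => H; apply: Rnot_le_lt => H0.
have E : Cmod z = 0%Re by apply: Rle_antisym => //; exact: Cmod_ge_0.
by have := re_le_Cmod z; rewrite E; have := Rle_abs (Re z); lra.
Qed.

Lemma slitP z : slit z <-> Im z <> 0%Re \/ (0 < Re z)%Re.
Proof.
rewrite /slit; have E := Cmod_sqr z; have P := Cmod_ge_0 z; split.
- move=> H; case: (Req_dec (Im z) 0) => [Hi|]; [right | by left].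
  rewrite Hi in E; apply: Rnot_le_lt => Hr; nra.
- case=> [H|H]; last lra.
  have : (0 < Im z * Im z)%Re by nra.
  nra.
Qed.

Lemma slit_add_pos z (t : R) : slit z -> (0 <= t)%Re -> slit (z + RtoC t).
Proof.
move=> /slitP H Ht; apply/slitP; rewrite im_plus re_plus im_RtoC re_RtoC Rplus_0_r.
case: H => H; [by left | right; lra].
Qed.

(** A point z of (-oo, 0] is sent to 0 by the shift t = -z. The digamma estimates provide lower
    bounds for all shifts at once, and membership in [slit] comes for free. *)
Lemma slit_of_shifts z : (forall t, (0 <= t)%Re -> (0 < Cmod (z + RtoC t))%Re) -> slit z.
Proof.
move=> H; apply/slitP; case: (Req_dec (Im z) 0) => [Hi|]; [right | by left].
apply: Rnot_le_lt => Hr.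
have := H (- Re z)%Re ltac:(lra).
have -> : z + RtoC (- Re z) = RtoC 0.
  by case: z Hi Hr H => a b /= -> _ _; rewrite /RtoC /Cplus /=; f_equal; ring.
rewrite Cmod_0; lra.
Qed.

Lemma off_cut_slit (u x : C) : u <> RtoC 0 -> off_cut u x -> slit (x / u).
Proof.
move=> Hu H; apply: slit_of_shifts => t Ht; apply/Cmod_gt_0 => E; apply: (H t Ht).
have -> : x = (x / u + RtoC t) * u - RtoC t * u by field.
by rewrite E; ring.
Qed.

(* With z = |z| e^(i theta) one can take delta = cos (theta / 2). *)
Lemma slit_lower z : slit z ->
  exists d : R, (0 < d)%Re /\ forall t, (0 <= t)%Re -> (d * (Cmod z + t) <= Cmod (z + RtoC t))%Re.
Proof.
move=> H; have Hr := slit_neq_0 H; rewrite /slit in H.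
have E := Cmod_sqr z.
set q := ((Cmod z + Re z) / (2 * Cmod z))%Re.
have Hq : (0 < q)%Re by apply: Rdiv_lt_0_compat; lra.
exists (sqrt q); split; first exact: sqrt_lt_R0.
move=> t Ht; apply: Rsqr_incr_0_var; last exact: Cmod_ge_0.
rewrite /Rsqr Cmod_sqr re_plus im_plus re_RtoC im_RtoC Rplus_0_r.
have -> : (sqrt q * (Cmod z + t) * (sqrt q * (Cmod z + t)) = (sqrt q * sqrt q) * ((Cmod z + t) * (Cmod z + t)))%Re by ring.
rewrite sqrt_def; last lra.
have Hre : (Re z <= Cmod z)%Re by apply: Rle_trans (Rle_abs _) (re_le_Cmod z).
have E2 : (Re z = (2 * q - 1) * Cmod z)%Re by rewrite /q; field; lra.
have Hq1 : (q <= 1)%Re.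
  by apply: (Rmult_le_reg_r (Cmod z)) => //; nra.
(* This product is exactly |z+t|^2 - q (|z|+t)^2. *)
have : (0 <= (1 - q) * ((Cmod z - t) * (Cmod z - t)))%Re.
  by apply: Rmult_le_pos; [lra | exact: Rle_0_sqr].
have -> : ((Re z + t) * (Re z + t) + Im z * Im z = Cmod z * Cmod z + 2 * t * Re z + t * t)%Re by rewrite E; ring.
rewrite E2; nra.
Qed.

(** Here q = b/(r+a) is tan (theta/2). The double-angle formulas give cos theta = (1-q^2)/(1+q^2)
    and sin theta = 2q/(1+q^2), and b^2 = (r-a)(r+a) turns these into a/r and b/r. *)
Lemma Cexp_Clog z : slit z -> Cexp (Clog z) = z.
Proof.
move=> H; have Hr := slit_neq_0 H; rewrite /slit in H.
have E := Cmod_sqr z.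
rewrite /Cexp /Clog /= exp_ln //.
set r := Cmod z in H Hr E *; set a := Re z in H E *; set b := Im z in H E *.
set q := (b / (r + a))%Re.
have Hq : (0 < 1 + q * q)%Re by nra.
have Hs : (0 < sqrt (1 + q * q))%Re by exact: sqrt_lt_R0.
have Hs2 : (sqrt (1 + q * q) * sqrt (1 + q * q) = 1 + q * q)%Re by rewrite sqrt_def //; lra.
rewrite cos_2a sin_2a cos_atan sin_atan /Rsqr.
move: (sqrt (1 + q * q)) Hs Hs2 => S Hs Hs2.
have -> : z = (a, b) by rewrite /a /b; case: (z).
have H1 : (1 / S * (1 / S) = / (1 + q * q))%Re by rewrite -Hs2; field; lra.
have H2 : (q / S * (q / S) = q * q / (1 + q * q))%Re by rewrite -Hs2; field; lra.
have H3 : (2 * (q / S) * (1 / S) = 2 * q / (1 + q * q))%Re by rewrite -Hs2; field; lra.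
rewrite H1 H2 H3 /Cmult /RtoC /=.
have Hra : (r + a <> 0)%Re by lra.
have Hd : ((r + a) * (r + a) + b * b = 2 * r * (r + a))%Re by nra.
have Hd0 : (2 * r * (r + a) <> 0)%Re by nra.
have E1 : (/ (1 + q * q) = (r + a) / (2 * r))%Re.
  have -> : (1 + q * q = ((r + a) * (r + a) + b * b) / ((r + a) * (r + a)))%Re by rewrite /q; field.
  by rewrite Hd; field; lra.
rewrite /Rdiv E1 /q; f_equal.
- have -> : (b / (r + a) * (b / (r + a)) = (r - a) / (r + a))%Re.
    have -> : (b / (r + a) * (b / (r + a)) = b * b / ((r + a) * (r + a)))%Re by field.
    have -> : (b * b = (r - a) * (r + a))%Re by lra.
    by field.
  by field; lra.
- by field; lra.
Qed.

Lemma Clog_scale z (r : R) : (0 < r)%Re -> slit z -> Clog (RtoC r * z) = Clog z + RtoC (ln r).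
Proof.
move=> Hr Hz; have Hz0 := slit_neq_0 Hz.
rewrite /Clog Cmod_mult Cmod_R re_scal_l im_scal_l Rabs_pos_eq; last lra.
rewrite ln_mult // /Cplus /RtoC /=; f_equal; first ring.
rewrite Rplus_0_r; f_equal; f_equal; field; rewrite /slit in Hz; split; first lra.
rewrite -Rmult_plus_distr_l; nra.
Qed.

Lemma Clog_1 : Clog (RtoC 1) = RtoC 0.
Proof. by rewrite /Clog Cmod_1 ln_1 /= /Rdiv Rmult_0_l atan_0 Rmult_0_r. Qed.

Lemma slit_pos_Re z : (0 < Re z)%Re -> slit z.
Proof. by move=> H; apply/slitP; right. Qed.

(** Real derivatives along a line replace the complex derivative of [Clog]: they suffice for the
    mean value theorem and for continuity along a segment. *)
Lemma is_derive_Clog_segment (a b : C) (t : R) : slit (a + RtoC t * b) ->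
  is_derive (fun t => Re (Clog (a + RtoC t * b))) t (Re (b / (a + RtoC t * b))) /\
  is_derive (fun t => Im (Clog (a + RtoC t * b))) t (Im (b / (a + RtoC t * b))).
Proof.
move=> H; have Hr := slit_neq_0 H.
have E := Cmod_sqr (a + RtoC t * b).
rewrite /slit in H.
case: a b H Hr E => [a1 a2] [b1 b2]; rewrite /Clog /Cmod /= => H Hr E.
set X := (a1 + (t * b1 - 0 * b2))%Re in H Hr E *.
set Y := (a2 + (t * b2 + 0 * b1))%Re in H Hr E *.
set r := sqrt _ in H Hr E.
have Hpos : (0 < X * (X * 1) + Y * (Y * 1))%Re by nra.
have Ep : (X * (X * 1) + Y * (Y * 1) = r * r)%Re by rewrite E; ring.
split; auto_derive;
  change (a1 + (t * b1 + - (0 * b2)))%Re with X; change (a2 + (t * b2 + 0 * b1))%Re with Y;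
  change (sqrt (X * (X * 1) + Y * (Y * 1))) with r.
- by [].
- by rewrite Ep; field; lra.
- by split=> //; split=> //; lra.
- rewrite Ep.
  have -> : (1 + Y * / (r + X) * (Y * / (r + X) * 1) = 2 * r / (r + X))%Re.
    have -> : (Y * / (r + X) * (Y * / (r + X) * 1) = Y * Y / ((r + X) * (r + X)))%Re by field; lra.
    have -> : (Y * Y = (r - X) * (r + X))%Re by lra.
    by field; lra.
  apply: Rminus_diag_uniq.
  transitivity (b2 * (r * r - (X * X + Y * Y)) / (r * r * (r + X)))%Re; first by field; lra.
  by rewrite E Rminus_diag_eq // Rmult_0_r /Rdiv Rmult_0_l.
Qed.

(** The mean value theorem does not hold for complex-valued functions; it is applied to the real and
    the imaginary part separately, whence the factor 2. *)
Lemma Clog_segment_bound (a b : C) (K : R) :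
  (forall t, (0 <= t <= 1)%Re ->
     slit (a + RtoC t * b) /\ (Cmod (b / (a + RtoC t * b) - b / a) <= K)%Re) ->
  (Cmod (Clog (a + b) - Clog a - b / a) <= 2 * K)%Re.
Proof.
move=> H.
have MV (f df : R -> R) (m : R) :
    (forall t, (0 <= t <= 1)%Re -> is_derive f t (df t)) ->
    (forall t, (0 <= t <= 1)%Re -> (Rabs (df t - m) <= K)%Re) ->
    (Rabs (f 1%Re - f 0%Re - m) <= K)%Re.
  move=> Hf Hm.
  have [|t|c [Hc ->]] := @MVT_gen f 0%Re 1%Re df.
  - by move=> t Ht; apply: Hf; move: Ht; rewrite Rmin_left ?Rmax_right; lra.
  - rewrite Rmin_left ?Rmax_right; try lra; move=> Ht.
    apply: derivable_continuous_pt; exists (df t); apply/is_derive_Reals; exact: Hf.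
  - rewrite Rminus_0_r Rmult_1_r; apply: Hm.
    by move: Hc; rewrite Rmin_left ?Rmax_right; lra.
have E0 : a + RtoC 0 * b = a by ring.
have E1 : a + RtoC 1 * b = a + b by ring.
have H1 := MV _ _ (Re (b / a)) (fun t Ht => proj1 (is_derive_Clog_segment (proj1 (H t Ht))))
  (fun t Ht => Rle_trans _ _ _ (re_le_Cmod (_ - _)) (proj2 (H t Ht))).
have H2 := MV _ _ (Im (b / a)) (fun t Ht => proj2 (is_derive_Clog_segment (proj1 (H t Ht))))
  (fun t Ht => Rle_trans _ _ _ (im_le_Cmod (_ - _)) (proj2 (H t Ht))).
rewrite E0 E1 in H1 H2.
apply: Rle_trans (Cmod_le_parts _) _.
have -> : Re (Clog (a + b) - Clog a - b / a) = (Re (Clog (a + b)) - Re (Clog a) - Re (b / a))%Re by [].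
have -> : Im (Clog (a + b) - Clog a - b / a) = (Im (Clog (a + b)) - Im (Clog a) - Im (b / a))%Re by [].
lra.
Qed.

Lemma Cmod_1p_lower (y : C) (t : R) : (Cmod y <= 1 / 2)%Re -> (0 <= t <= 1)%Re ->
  (1 / 2 <= Re (RtoC 1 + RtoC t * y))%Re.
Proof.
move=> Hy Ht; rewrite re_plus re_RtoC re_scal_l.
have := re_le_Cmod y; move=> H.
have /Rabs_le_between H2 : (Rabs (Re y) <= 1 / 2)%Re by lra.
nra.
Qed.

Lemma Clog_1p_bound (y : C) : (Cmod y <= 1 / 2)%Re ->
  (Cmod (Clog (RtoC 1 + y) - y) <= 4 * (Cmod y * Cmod y))%Re.
Proof.
move=> Hy.
have E : Clog (RtoC 1 + y) - y = Clog (RtoC 1 + y) - Clog (RtoC 1) - y / RtoC 1.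
  by rewrite Clog_1; field; exact: C1_nz.
rewrite E; have -> : (4 * (Cmod y * Cmod y) = 2 * (2 * (Cmod y * Cmod y)))%Re by ring.
apply: Clog_segment_bound => t Ht.
have Hl := Cmod_1p_lower Hy Ht.
split; first by apply: slit_pos_Re; lra.
have Hm : (1 / 2 <= Cmod (RtoC 1 + RtoC t * y))%Re.
  by apply: Rle_trans Hl _; apply: Rle_trans (Rle_abs _) (re_le_Cmod _).
have Hn : RtoC 1 + RtoC t * y <> RtoC 0 by apply/Cmod_gt_0; lra.
have -> : y / (RtoC 1 + RtoC t * y) - y / RtoC 1 = - (RtoC t * (y * y)) / (RtoC 1 + RtoC t * y).
  by field.
rewrite Cmod_div // Cmod_opp !Cmod_mult Cmod_R Rabs_pos_eq; last lra.
apply: (Rmult_le_reg_r (Cmod (RtoC 1 + RtoC t * y))); first lra.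
rewrite /Rdiv Rmult_assoc Rinv_l ?Rmult_1_r; last lra.
have := Cmod_ge_0 y => H0.
have : (t * (Cmod y * Cmod y) <= 1 * (Cmod y * Cmod y))%Re by apply: Rmult_le_compat_r; [nra|lra].
have : (Cmod y * Cmod y * (1 / 2) <= Cmod y * Cmod y * Cmod (RtoC 1 + RtoC t * y))%Re
  by apply: Rmult_le_compat_l; [nra|lra].
lra.
Qed.

(* For z on the negative half-line the value of [Clog z] is not a logarithm. *)
Lemma Clog_exists (z : C) : z <> RtoC 0 ->
  exists l, Cexp l = z /\ (slit z -> l = Clog z).
Proof.
move=> Hz; case: (Rlt_dec 0 (Cmod z + Re z)) => H; first by exists (Clog z); rewrite Cexp_Clog.
exists (Clog (- z) + (0, PI)); split; last by [].
have Hs : slit (- z).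
  have Hz0 := proj1 (Cmod_gt_0 z) Hz.
  have Hr : (Re (- z) = - Re z)%Re by [].
  apply: slit_pos_Re; rewrite Hr; lra.
rewrite Cexp_add Cexp_Clog // /Cexp /= exp_0 cos_PI sin_PI.
by case: (z) => x y; rewrite /Cmult /RtoC /Copp /=; f_equal; ring.
Qed.

(** * Gauss' product and the digamma function *)

Lemma is_lim_seq_inv_shift (c : R) : is_lim_seq (fun n => / (c + INR n))%Re 0%Re.
Proof.
have H : is_lim_seq (fun n => c + INR n)%Re p_infty.
  by apply: (is_lim_seq_plus _ _ c p_infty p_infty) => //;
     [exact: is_lim_seq_const | exact: is_lim_seq_INR].
exact: (is_lim_seq_inv _ p_infty).
Qed.

Notation csum_n := (@sum_n C_NormedModule).

Lemma csum_n0 (a : nat -> C) : csum_n a 0%N = a 0%N :> C.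
Proof. exact: sum_O. Qed.

Lemma csum_nS (a : nat -> C) m : csum_n a m.+1 = csum_n a m + a m.+1 :> C.
Proof. exact: sum_Sn. Qed.

(** Domination by a telescoping series gives convergence and an explicit bound on the sum together.
    Terms of order 1/(r+k)^2 are brought to this form by [inv_sqr_telescope]. *)
Lemma series_telescope_bound (a : nat -> C) (B r : R) : (0 < r)%Re -> (0 <= B)%Re ->
  (forall k, (Cmod (a k) <= B * (/ (r + INR k) - / (r + INR k.+1)))%Re) ->
  exists S : C, filterlim (csum_n a) eventually (locally S) /\
                (Cmod S <= B / r)%Re.
Proof.
move=> Hr HB Ha.
pose b k := (B * (/ (r + INR k) - / (r + INR k.+1)))%Re.
have Eb m : sum_n b m = (B * (/ r - / (r + INR m.+1)))%Re.
  elim: m => [|m IH]; first by rewrite sum_O /b /= Rplus_0_r.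
  by rewrite sum_Sn IH /b /plus /=; ring.
have Hb : ex_series b.
  exists (B * (/ r - 0))%Re; change (is_lim_seq (sum_n b) (B * (/ r - 0))%Re).
  apply: (is_lim_seq_ext (fun m => B * (/ r - / (r + INR m.+1)))%Re).
    by move=> m; rewrite Eb.
  apply: (is_lim_seq_scal_l _ B (Rbar.Finite (/ r - 0)%Re)).
  apply: is_lim_seq_minus'; first exact: is_lim_seq_const.
  exact: (proj1 (is_lim_seq_incr_1 _ _) (is_lim_seq_inv_shift r)).
have [S HS] := @ex_series_le C_AbsRing C_CompleteNormedModule a b Ha Hb.
exists S; split; first exact: HS.
apply: (@Cmod_lim_le nat eventually _ (csum_n a) S (B / r) _ HS).
exists 0%N => m _; apply: (Rle_trans _ (sum_n b m)).
  elim: m => [|m IH]; first by rewrite !sum_O; exact: Ha.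
  rewrite csum_nS sum_Sn; apply: Rle_trans (Cmod_triangle _ _) _.
  by apply: Rplus_le_compat IH _; exact: Ha.
rewrite Eb /Rdiv; apply: Rmult_le_compat_l => //.
have : (0 < / (r + INR m.+1))%Re by apply: Rinv_0_lt_compat; have := pos_INR m.+1; lra.
lra.
Qed.

Lemma inv_sqr_telescope (r : R) (k : nat) : (1 <= r)%Re ->
  (/ ((r + INR k) * (r + INR k)) <= 2 * (/ (r + INR k) - / (r + INR k.+1)))%Re.
Proof.
move=> Hr; rewrite S_INR; have := pos_INR k; move: (INR k) => x Hx.
have -> : (/ (r + x) - / (r + (x + 1)) = / ((r + x) * (r + x + 1)))%Re by field; lra.
have -> : (2 * / ((r + x) * (r + x + 1)) = / ((r + x) * ((r + x + 1) / 2)))%Re by field; lra.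
apply: Rinv_le_contravar; first nra.
apply: Rmult_le_compat_l; lra.
Qed.

(** The logarithmic derivative in x of [Gamma_approx x m]. *)
Definition digamma_approx (x : C) (m : nat) : C :=
  RtoC (ln (INR m)) - csum_n (fun k => / (x + RtoC (INR k))) m.

Definition digamma (x : C) : C :=
  (real (Lim_seq (fun m => Re (digamma_approx x m))),
   real (Lim_seq (fun m => Im (digamma_approx x m)))).

(** [Gamma] and [digamma] are built from the total function [Lim_seq] on coordinates; convergence of
    the complex sequence is what gives these values a meaning. *)
Lemma Lim_seq_C (f : nat -> C) (l : C) :
  filterlim f eventually (locally l) ->
  (real (Lim_seq (fun m => Re (f m))), real (Lim_seq (fun m => Im (f m)))) = l.
Proof.
move=> H.
have H1 : is_lim_seq (fun m => Re (f m)) (Re l) by exact: filterlim_Re.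
have H2 : is_lim_seq (fun m => Im (f m)) (Im l) by exact: filterlim_Im.
by rewrite (is_lim_seq_unique _ _ H1) (is_lim_seq_unique _ _ H2); case: (l).
Qed.

Lemma INR_SC k : RtoC (INR k.+1) = RtoC (INR k) + RtoC 1.
Proof. by rewrite S_INR RtoC_plus. Qed.

Lemma slit_shift_neq_0 (x : C) k : slit x -> x + RtoC (INR k) <> RtoC 0.
Proof. by move=> Hx; apply/Cmod_gt_0; apply: slit_neq_0; apply: slit_add_pos => //; exact: pos_INR. Qed.

(** The error in replacing 1/(x+k) by the integral of 1/t from x+k to x+k+1. *)
Definition log_defect (x : C) (k : nat) : C :=
  Clog (x + RtoC (INR k.+1)) - Clog (x + RtoC (INR k)) - / (x + RtoC (INR k)).

Lemma digamma_approx_log (x : C) m :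
  digamma_approx x m =
  Clog x + (RtoC (ln (INR m)) - Clog (x + RtoC (INR m.+1)))
  + csum_n (log_defect x) m.
Proof.
have E : csum_n (fun k => / (x + RtoC (INR k))) m =
  Clog (x + RtoC (INR m.+1)) - Clog x - csum_n (log_defect x) m :> C.
  elim: m => [|m IH].
    by rewrite !csum_n0 /log_defect /= Cplus_0_r; ring.
  by rewrite !csum_nS IH {3}/log_defect; ring.
by rewrite /digamma_approx E; ring.
Qed.

(** The constant 4 is the factor 2 of [Clog_segment_bound] times the factor 2 of
    [inv_sqr_telescope]. The parameter r is kept free so that the summed bound decays like 1/r as x
    goes to infinity. *)
Lemma log_defect_bound (x : C) (d r : R) k : (0 < d)%Re -> (1 <= r)%Re ->
  (forall t, (0 <= t)%Re -> (d * (r + t) <= Cmod (x + RtoC t))%Re) ->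
  (Cmod (log_defect x k) <= 4 / (d * d) * (/ (r + INR k) - / (r + INR k.+1)))%Re.
Proof.
move=> Hd Hr H.
have Hk := pos_INR k.
have Hpos t : (0 <= t)%Re -> (0 < Cmod (x + RtoC t))%Re.
  move=> Ht; apply: Rlt_le_trans (H t Ht); apply: Rmult_lt_0_compat; lra.
have -> : log_defect x k =
  Clog (x + RtoC (INR k) + RtoC 1) - Clog (x + RtoC (INR k)) - RtoC 1 / (x + RtoC (INR k)).
  rewrite /log_defect INR_SC Cplus_assoc; congr (_ - _); rewrite /Cdiv; ring.
apply: (Rle_trans _ (2 * / (d * (r + INR k) * (d * (r + INR k))))).
  apply: Clog_segment_bound => t Ht.
  have E : x + RtoC (INR k) + RtoC t * RtoC 1 = x + RtoC (INR k + t).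
    by rewrite RtoC_plus; ring.
  rewrite E; have Ht' : (0 <= INR k + t)%Re by lra.
  split.
    apply: slit_of_shifts => t' Ht2; rewrite -Cplus_assoc -RtoC_plus; apply: Hpos; lra.
  have N1 := proj2 (Cmod_gt_0 _) (Hpos _ Hk).
  have N2 := proj2 (Cmod_gt_0 _) (Hpos _ Ht').
  have -> : RtoC 1 / (x + RtoC (INR k + t)) - RtoC 1 / (x + RtoC (INR k)) =
    - RtoC t / ((x + RtoC (INR k)) * (x + RtoC (INR k + t))).
    by move: N1 N2; rewrite RtoC_plus => N1 N2; field.
  rewrite Cmod_div; last exact: Cmult_neq_0.
  rewrite Cmod_opp Cmod_R Cmod_mult Rabs_pos_eq; last lra.
  have P : (0 < d * (r + INR k))%Re by apply: Rmult_lt_0_compat; lra.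
  have P1 := H _ Hk; have P2 := H _ Ht'.
  have P3 : (d * (r + INR k) <= d * (r + (INR k + t)))%Re by apply: Rmult_le_compat_l; lra.
  apply: (Rle_trans _ (1 * / (Cmod (x + RtoC (INR k)) * Cmod (x + RtoC (INR k + t))))).
    apply: Rmult_le_compat_r; last lra.
    by apply: Rlt_le; apply: Rinv_0_lt_compat; apply: Rmult_lt_0_compat; lra.
  rewrite Rmult_1_l; apply: Rinv_le_contravar; first exact: Rmult_lt_0_compat.
  by apply: Rmult_le_compat; lra.
have := inv_sqr_telescope k Hr => Hq.
have -> : (2 * / (d * (r + INR k) * (d * (r + INR k))) =
  2 / (d * d) * / ((r + INR k) * (r + INR k)))%Re by field; lra.
have -> : (4 / (d * d) * (/ (r + INR k) - / (r + INR k.+1)) =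
  2 / (d * d) * (2 * (/ (r + INR k) - / (r + INR k.+1))))%Re by rewrite /Rdiv; ring.
apply: Rmult_le_compat_l => //; apply: Rlt_le; apply: Rdiv_lt_0_compat; nra.
Qed.

Lemma Clog_shift_lim (x : C) :
  filterlim (fun m => RtoC (ln (INR m)) - Clog (x + RtoC (INR m.+1))) eventually
    (locally (RtoC 0)).
Proof.
have Hc := Cmod_ge_0 (x + RtoC 1); set c := Cmod (x + RtoC 1) in Hc.
(* With x+m+1 = m (1+y) and |y| = c/m <= 1/2, one has |Log (1+y)| <= |y| + 4 |y|^2 <= 3 |y|. *)
apply: (@filterlim_C_bound _ _ _ _ _ (fun m => 3 * c * / (0 + INR m))%Re); last first.
  have := is_lim_seq_scal_l _ (3 * c)%Re _ (is_lim_seq_inv_shift 0).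
  by rewrite /= Rmult_0_r.
have [N HN] := INR_unbounded (2 * c + 1).
exists N => m Hm.
have Hm1 : (2 * c + 1 < INR m)%Re by apply: Rlt_le_trans HN _; exact: le_INR.
set y := (x + RtoC 1) / RtoC (INR m).
have Hm0 : RtoC (INR m) <> RtoC 0 by move=> /RtoC_inj; lra.
have Hcy : Cmod y = (c * / INR m)%Re.
  by rewrite /y Cmod_div // Cmod_R Rabs_pos_eq //; lra.
have Hy : (Cmod y <= 1 / 2)%Re.
  rewrite Hcy; apply: (Rmult_le_reg_r (INR m)); first lra.
  rewrite Rmult_assoc Rinv_l; lra.
have E : x + RtoC (INR m.+1) = RtoC (INR m) * (RtoC 1 + y) by rewrite INR_SC /y; field.
have Hs : slit (RtoC 1 + y).
  apply: slit_pos_Re; have := @Cmod_1p_lower y 1 Hy ltac:(lra).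
  by rewrite Cmult_1_l; lra.
rewrite E Clog_scale //; last lra.
have -> : RtoC (ln (INR m)) - (Clog (RtoC 1 + y) + RtoC (ln (INR m))) - RtoC 0 =
  - ((Clog (RtoC 1 + y) - y) + y) by ring.
rewrite Cmod_opp; apply: Rle_trans (Cmod_triangle _ _) _.
have := Clog_1p_bound Hy; have := Cmod_ge_0 y => H0 H1.
rewrite Rplus_0_l Rmult_assoc -Hcy; nra.
Qed.

(** The difference digamma(x) - Log x is the sum of all [log_defect x k]. Taking r = 1 gives
    convergence at any point of [slit]; taking r proportional to 1/e gives the asymptotics on a
    ray. *)
Lemma digamma_lim_bound (x : C) (d r : R) : (0 < d)%Re -> (1 <= r)%Re ->
  (forall t, (0 <= t)%Re -> (d * (r + t) <= Cmod (x + RtoC t))%Re) ->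
  filterlim (digamma_approx x) eventually (locally (digamma x)) /\
  (Cmod (digamma x - Clog x) <= 4 / (d * d) / r)%Re.
Proof.
move=> Hd Hr H.
have Hr0 : (0 < r)%Re by lra.
have HB : (0 <= 4 / (d * d))%Re by apply: Rlt_le; apply: Rdiv_lt_0_compat; nra.
have [S [HS1 HS2]] := series_telescope_bound Hr0 HB (fun k => log_defect_bound k Hd Hr H).
have HL : filterlim (digamma_approx x) eventually (locally (Clog x + RtoC 0 + S)).
  apply: (filterlim_ext (fun m => Clog x + (RtoC (ln (INR m)) - Clog (x + RtoC (INR m.+1)))
    + csum_n (log_defect x) m)).
    by move=> m; rewrite digamma_approx_log.
  apply: filterlim_Cplus HS1; apply: filterlim_Cplus (Clog_shift_lim x).
  exact: filterlim_const.
have E : digamma x = Clog x + RtoC 0 + S by exact: Lim_seq_C.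
rewrite E; split; first exact: HL.
by have -> : Clog x + RtoC 0 + S - Clog x = S by ring.
Qed.

Lemma slit_lower_unit (x : C) : slit x ->
  exists d, (0 < d)%Re /\ forall t, (0 <= t)%Re -> (d * (1 + t) <= Cmod (x + RtoC t))%Re.
Proof.
move=> H; have [d [Hd Hb]] := slit_lower H; have Hx := slit_neq_0 H.
have Hm : (0 < Rmin 1 (Cmod x))%Re by apply: Rmin_glb_lt; lra.
exists (d * Rmin 1 (Cmod x))%Re; split; first exact: Rmult_lt_0_compat.
move=> t Ht; apply: Rle_trans (Hb t Ht); rewrite Rmult_assoc; apply: Rmult_le_compat_l; first lra.
have := Rmin_l 1 (Cmod x); have := Rmin_r 1 (Cmod x); nra.
Qed.

Lemma digamma_lim (x : C) : slit x ->
  filterlim (digamma_approx x) eventually (locally (digamma x)).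
Proof.
move=> /slit_lower_unit [d [Hd H]].
by have [] := digamma_lim_bound Hd (Rle_refl 1) H.
Qed.

(** * The Gamma function *)

Lemma not_pole_shift (x : C) : ~ Gamma_pole x -> forall k, x + RtoC (INR k) <> RtoC 0.
Proof.
move=> H k E; apply: H; exists k.
have -> : x = x + RtoC (INR k) - RtoC (INR k) by ring.
by rewrite E; ring.
Qed.

Lemma slit_not_pole (x : C) : slit x -> ~ Gamma_pole x.
Proof.
move=> Hx [k E]; apply: (@slit_shift_neq_0 x k Hx); rewrite E; ring.
Qed.

(** The Pochhammer symbol with m+1 factors, the denominator of [Gamma_approx x m]. *)
Definition rising (x : C) (m : nat) : C := \cprod_(k in 'I_m.+1) (x + RtoC (INR k)).

Lemma risingS (x : C) m : rising x m.+1 = rising x m * (x + RtoC (INR m.+1)).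
Proof. by rewrite /rising big_ord_recr. Qed.

Lemma rising0 (x : C) : rising x 0 = x + RtoC (INR 0).
Proof. rewrite /rising big_ord_recr big_ord0; exact: Cmult_1_l. Qed.

Lemma rising_neq_0 (x : C) m : (forall k, x + RtoC (INR k) <> RtoC 0) -> rising x m <> RtoC 0.
Proof.
move=> H; elim: m => [|m IH]; first by rewrite rising0; exact: H.
by rewrite risingS; apply: Cmult_neq_0.
Qed.

(** The first-order parts (x-x0)/(x0+k) of the logarithms of (x+k)/(x0+k) combine with m^(x-x0) into
    (x-x0) times [digamma_approx x0 m]; what remains is summable. Any logarithms [l k] are allowed,
    so the finitely many factors that may lie outside the principal branch do no harm. *)
Lemma Gamma_approx_ratio (x x0 : C) (l : nat -> C) m :
  (forall k, x + RtoC (INR k) <> RtoC 0) -> (forall k, x0 + RtoC (INR k) <> RtoC 0) ->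
  (forall k, Cexp (l k) = RtoC 1 + (x - x0) / (x0 + RtoC (INR k))) ->
  Gamma_approx x m = Gamma_approx x0 m *
    Cexp ((x - x0) * digamma_approx x0 m
          - csum_n (fun k => l k - (x - x0) / (x0 + RtoC (INR k))) m).
Proof.
move=> Hx Hx0 Hl.
have E : rising x m = rising x0 m * Cexp (csum_n l m).
  elim: m => [|m IH].
    rewrite !rising0 csum_n0 Hl; field; exact: Hx0.
  rewrite !risingS csum_nS Cexp_add IH Hl; field; exact: Hx0.
have E2 : csum_n (fun k => l k - (x - x0) / (x0 + RtoC (INR k))) m =
  csum_n l m - (x - x0) * csum_n (fun k => / (x0 + RtoC (INR k))) m :> C.
  elim: (m) => [|k IH]; first by rewrite !csum_n0.
  by rewrite !csum_nS IH /Cdiv; ring.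
rewrite E2 /digamma_approx /Gamma_approx -/(rising x m) -/(rising x0 m) E.
have -> : (x - x0) * (RtoC (ln (INR m)) - csum_n (fun k => / (x0 + RtoC (INR k))) m)
  - (csum_n l m - (x - x0) * csum_n (fun k => / (x0 + RtoC (INR k))) m)
  = x * RtoC (ln (INR m)) + (- (x0 * RtoC (ln (INR m))) + - csum_n l m) by ring.
have -> : Cexp (x * RtoC (ln (INR m)) + (- (x0 * RtoC (ln (INR m))) + - csum_n l m)) =
  Cexp (x * RtoC (ln (INR m))) / (Cexp (x0 * RtoC (ln (INR m))) * Cexp (csum_n l m)).
  rewrite Cexp_add Cexp_add !Cexp_opp; field; split; exact: Cexp_neq_0.
by field; repeat split; try exact: Cexp_neq_0; exact: rising_neq_0.
Qed.

(** The index is shifted because [ln 0] is 0 by convention, so that at index 0 the power m^1 would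
    be 1 instead of 0. *)
Lemma Gamma_approx_1 m : Gamma_approx (RtoC 1) m.+1 = RtoC (1 - / (1 + INR m.+1)).
Proof.
have E : forall m, rising (RtoC 1) m = RtoC (INR (fact m.+1)).
  elim=> [|k IH]; first by rewrite rising0 /= -RtoC_plus; congr RtoC; ring.
  rewrite risingS IH -RtoC_plus -RtoC_mult; congr RtoC.
  by rewrite (fact_simpl k.+1) mult_INR (S_INR k.+1); ring.
rewrite /Gamma_approx -/(rising (RtoC 1) m.+1) E Cmult_1_l Cexp_R exp_ln; last exact: lt_0_INR (PeanoNat.Nat.lt_0_succ m).
rewrite (fact_simpl m.+1) mult_INR.
have Hf := INR_fact_neq_0 m.+1.
have Hm := pos_INR m.+1.
rewrite -RtoC_mult -RtoC_div; last by rewrite (S_INR m.+1); apply: Rmult_integral_contrapositive; split => //; lra.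
congr RtoC; rewrite (S_INR m.+1); by field; repeat split; try exact: Hf; lra.
Qed.

Lemma Gamma_approx_1_lim :
  filterlim (Gamma_approx (RtoC 1)) eventually (locally (RtoC 1)).
Proof.
apply: (@filterlim_C_bound _ _ _ _ _ (fun m => / (1 + INR m))%Re); last exact: is_lim_seq_inv_shift.
exists 1%N => [[|m]] Hm; first by lia.
rewrite Gamma_approx_1 -RtoC_minus Cmod_R.
have : (0 < / (1 + INR m.+1))%Re by apply: Rinv_0_lt_compat; have := pos_INR m.+1; lra.
move=> H; rewrite Rabs_left; lra.
Qed.

(** The condition on v makes the quotient v/(x0+k) at most 1/2 in modulus, so 1 plus it has positive
    real part and [l] is the principal logarithm. The constant 8 is the 4 of [Clog_1p_bound] times
    the 2 of [inv_sqr_telescope]. *)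
Lemma log_term_bound (x0 v l : C) (d : R) (k : nat) :
  (0 < d)%Re -> (d * (1 + INR k) <= Cmod (x0 + RtoC (INR k)))%Re ->
  (Cmod v <= d / 2 * (1 + INR k))%Re ->
  (slit (RtoC 1 + v / (x0 + RtoC (INR k))) -> l = Clog (RtoC 1 + v / (x0 + RtoC (INR k)))) ->
  (Cmod (l - v / (x0 + RtoC (INR k))) <=
     8 * (Cmod v * Cmod v) / (d * d) * (/ (1 + INR k) - / (1 + INR k.+1)))%Re.
Proof.
move=> Hd Hx Hv Hl; have Hk := pos_INR k.
have Hp : (0 < d * (1 + INR k))%Re by apply: Rmult_lt_0_compat; lra.
have Hn : x0 + RtoC (INR k) <> RtoC 0 by apply/Cmod_gt_0; lra.
set y := v / _ in Hl *.
have Hc : (Cmod y <= Cmod v / (d * (1 + INR k)))%Re.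
  rewrite /y Cmod_div //; apply: Rmult_le_compat_l; first exact: Cmod_ge_0.
  exact: Rinv_le_contravar.
have Hy : (Cmod y <= 1 / 2)%Re.
  apply: Rle_trans Hc _; apply: (Rmult_le_reg_r (d * (1 + INR k))) => //.
  rewrite /Rdiv Rmult_assoc Rinv_l; lra.
rewrite Hl; last first.
  apply: slit_pos_Re; have := @Cmod_1p_lower y 1 Hy ltac:(lra).
  by rewrite Cmult_1_l; lra.
apply: Rle_trans (Clog_1p_bound Hy) _.
have Hy0 := Cmod_ge_0 y.
have H2 : (Cmod y * Cmod y <= Cmod v / (d * (1 + INR k)) * (Cmod v / (d * (1 + INR k))))%Re.
  exact: Rmult_le_compat.
have Hq := inv_sqr_telescope k (Rle_refl 1).
apply: (Rle_trans _ (4 * (Cmod v * Cmod v) / (d * d) * / ((1 + INR k) * (1 + INR k)))).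
  have -> : (4 * (Cmod v * Cmod v) / (d * d) * / ((1 + INR k) * (1 + INR k)) =
    4 * (Cmod v / (d * (1 + INR k)) * (Cmod v / (d * (1 + INR k)))))%Re by field; lra.
  lra.
have -> : (8 * (Cmod v * Cmod v) / (d * d) * (/ (1 + INR k) - / (1 + INR k.+1)) =
  4 * (Cmod v * Cmod v) / (d * d) * (2 * (/ (1 + INR k) - / (1 + INR k.+1))))%Re by rewrite /Rdiv; ring.
apply: Rmult_le_compat_l => //.
have := Cmod_ge_0 v => Hv0.
by apply: Rmult_le_pos; [nra | apply: Rlt_le; apply: Rinv_0_lt_compat; nra].
Qed.

(** Comparison with the base point 1, where the product tends to 1. Away from the poles every factor
    has a logarithm, and the limit, being an exponential, does not vanish. *)
Lemma Gamma_lim (x : C) : ~ Gamma_pole x ->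
  filterlim (Gamma_approx x) eventually (locally (Gamma x)) /\ Gamma x <> RtoC 0.
Proof.
move=> /not_pole_shift Hx.
have S1 : slit (RtoC 1) by apply: slit_pos_Re => /=; lra.
have H1 k := @slit_shift_neq_0 (RtoC 1) k S1.
set v := x - RtoC 1.
have Hw k : RtoC 1 + v / (RtoC 1 + RtoC (INR k)) <> RtoC 0.
  have -> : RtoC 1 + v / (RtoC 1 + RtoC (INR k)) = (x + RtoC (INR k)) / (RtoC 1 + RtoC (INR k)).
    by rewrite /v; field; exact: H1.
  by apply: Cmult_neq_0 => //; move=> E; have := Cinv_r _ (H1 k); rewrite E Cmult_0_r => /RtoC_inj; lra.
have [l Hl] := choice _ (fun k => Clog_exists (Hw k)).
pose a k := l k - v / (RtoC 1 + RtoC (INR k)).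
(* Beyond N the quotient v/(1+k) has modulus at most 1/2 and [l k] is principal; the earlier terms
   do not affect convergence. *)
have [N HN] := INR_unbounded (2 * Cmod v).
have Ha : @ex_series C_AbsRing C_NormedModule (fun k => a (N.+1 + k)%coq_nat).
  have Hr : (0 < 1 + INR N.+1)%Re by have := pos_INR N.+1; lra.
  have HB : (0 <= 8 * (Cmod v * Cmod v) / (1 * 1))%Re by have := Cmod_ge_0 v; nra.
  have [|S [HS _]] := @series_telescope_bound (fun k => a (N.+1 + k)%coq_nat) _ _ Hr HB; last by exists S.
  move=> k.
  have -> : (1 + INR N.+1 + INR k = 1 + INR (N.+1 + k)%coq_nat)%Re by rewrite plus_INR; ring.
  have -> : (1 + INR N.+1 + INR k.+1 = 1 + INR (N.+1 + k)%coq_nat.+1)%Re by rewrite -PeanoNat.Nat.add_succ_r plus_INR; ring.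
  apply: log_term_bound; try lra.
  - rewrite -RtoC_plus Cmod_R Rmult_1_l; exact: Rle_abs.
  - rewrite plus_INR S_INR; have := pos_INR k; lra.
  - exact: (proj2 (Hl _)).
have [S HS] : @ex_series C_AbsRing C_NormedModule a.
  exact: (proj2 (@ex_series_incr_n C_AbsRing C_NormedModule a N.+1) Ha).
have HL : filterlim (Gamma_approx x) eventually
    (locally (RtoC 1 * Cexp (v * digamma (RtoC 1) - S))).
  apply: (filterlim_ext (fun m => Gamma_approx (RtoC 1) m *
      Cexp (v * digamma_approx (RtoC 1) m - csum_n a m))).
    by move=> m; rewrite (@Gamma_approx_ratio x (RtoC 1) l m Hx H1) // => k; exact: (proj1 (Hl k)).
  apply: filterlim_Cmult; first exact: Gamma_approx_1_lim.
  apply: filterlim_Cexp; apply: filterlim_Cminus; last exact: HS.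
  apply: filterlim_Cmult; [exact: filterlim_const | exact: digamma_lim].
have E : Gamma x = RtoC 1 * Cexp (v * digamma (RtoC 1) - S) by exact: Lim_seq_C.
rewrite E; split; first exact: HL.
by apply: Cmult_neq_0; [exact: C1_nz | exact: Cexp_neq_0].
Qed.

(** Comparison with x0 itself. The radius d/2 makes the logarithms of all factors principal,
    including k = 0, so the whole series of remainders is O(|x-x0|^2). This estimate stands in for
    the theorem on derivatives of locally uniform limits. *)
Lemma Gamma_local (x0 : C) : slit x0 -> exists (r K : R), (0 < r)%Re /\ (0 <= K)%Re /\
  forall x, (Cmod (x - x0) < r)%Re -> exists E : C,
    Gamma x = Gamma x0 * Cexp ((x - x0) * digamma x0 - E) /\
    (Cmod E <= K * (Cmod (x - x0) * Cmod (x - x0)))%Re.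
Proof.
move=> Hs; have [d [Hd Hb]] := slit_lower_unit Hs.
exists (d / 2)%Re, (8 / (d * d))%Re; split; first lra.
split; first by apply: Rlt_le; apply: Rdiv_lt_0_compat; nra.
move=> x Hx; set v := x - x0.
have H0 k := @slit_shift_neq_0 x0 k Hs.
have Hbk k := Hb _ (pos_INR k).
have Hv k : (Cmod v <= d / 2 * (1 + INR k))%Re by have := pos_INR k; rewrite -/v in Hx; nra.
have Hx' k : x + RtoC (INR k) <> RtoC 0.
  move=> E; have := Hbk k; have := Hv k; rewrite /v.
  have -> : x - x0 = x + RtoC (INR k) - (x0 + RtoC (INR k)) by ring.
  have P := pos_INR k.
  have Q : (0 < d * (1 + INR k))%Re by apply: Rmult_lt_0_compat; lra.
  rewrite E; have -> : RtoC 0 - (x0 + RtoC (INR k)) = - (x0 + RtoC (INR k)) by ring.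
  rewrite Cmod_opp; lra.
have Hw k : RtoC 1 + v / (x0 + RtoC (INR k)) <> RtoC 0.
  have -> : RtoC 1 + v / (x0 + RtoC (INR k)) = (x + RtoC (INR k)) * / (x0 + RtoC (INR k)).
    by rewrite /v; field; exact: H0.
  by apply: Cmult_neq_0 => //; move=> E; have := Cinv_r _ (H0 k); rewrite E Cmult_0_r => /RtoC_inj; lra.
have [l Hl] := choice _ (fun k => Clog_exists (Hw k)).
have HB : (0 <= 8 * (Cmod v * Cmod v) / (d * d))%Re.
  have := Cmod_ge_0 v => P; apply: Rmult_le_pos; first nra.
  by apply: Rlt_le; apply: Rinv_0_lt_compat; nra.
have [|S [HS1 HS2]] := @series_telescope_bound (fun k => l k - v / (x0 + RtoC (INR k))) _ 1 Rlt_0_1 HB.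
  by move=> k; apply: log_term_bound => //; exact: (proj2 (Hl _)).
exists S; split; last by move: HS2; rewrite /Rdiv Rinv_1 -/v; lra.
have [G0 _] := Gamma_lim (slit_not_pole Hs).
apply: Lim_seq_C.
apply: (filterlim_ext (fun m => Gamma_approx x0 m *
      Cexp (v * digamma_approx x0 m - csum_n (fun k => l k - v / (x0 + RtoC (INR k))) m))).
  by move=> m; rewrite (@Gamma_approx_ratio x x0 l m Hx' H0) // => k; exact: (proj1 (Hl k)).
apply: filterlim_Cmult; first exact: G0.
apply: filterlim_Cexp; apply: filterlim_Cminus HS1.
apply: filterlim_Cmult; [exact: filterlim_const | exact: digamma_lim].
Qed.

Lemma is_derive_Gamma (x0 : C) : slit x0 ->
  @is_derive C_AbsRing C_NormedModule Gamma x0 (Gamma x0 * digamma x0).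
Proof.
move=> Hs; have [r [K [Hr [HK H]]]] := Gamma_local Hs.
set g := Gamma x0; set p := digamma x0.
have Hg := Cmod_ge_0 g; have Hp := Cmod_ge_0 p.
(* For n = |x-x0| < 1 the exponent is at most A n in modulus, and M n^2 bounds the whole remainder.
   The radius chosen below also makes the exponent at most 1/2, as [Cexp_sub_bound] requires. *)
pose A := (Cmod p + K)%Re.
have HA : (0 <= A)%Re by rewrite /A; lra.
pose M := (Cmod g * (10 * (A * A) + K))%Re.
have HM : (0 <= M)%Re by apply: Rmult_le_pos => //; nra.
apply/is_C_derive_spec => eps He.
exists (Rmin (Rmin r 1) (Rmin (/ (2 * (A + 1))) (eps / (M + 1)))); split.
  apply: Rmin_glb_lt; first by apply: Rmin_glb_lt; lra.
  by apply: Rmin_glb_lt; [apply: Rinv_0_lt_compat; lra | apply: Rdiv_lt_0_compat; lra].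
move=> x Hx; have Hn := Cmod_ge_0 (x - x0).
have Hx1 : (Cmod (x - x0) < r)%Re.
  by apply: Rlt_le_trans Hx _; apply: Rle_trans (Rmin_l _ _) (Rmin_l _ _).
have Hx2 : (Cmod (x - x0) < 1)%Re.
  by apply: Rlt_le_trans Hx _; apply: Rle_trans (Rmin_l _ _) (Rmin_r _ _).
have Hx3 : (Cmod (x - x0) < / (2 * (A + 1)))%Re.
  by apply: Rlt_le_trans Hx _; apply: Rle_trans (Rmin_r _ _) (Rmin_l _ _).
have Hx4 : (Cmod (x - x0) < eps / (M + 1))%Re.
  by apply: Rlt_le_trans Hx _; apply: Rle_trans (Rmin_r _ _) (Rmin_r _ _).
have [E [-> HE]] := H x Hx1.
rewrite -/g -/p; set v := x - x0 in Hn Hx1 Hx2 Hx3 Hx4 HE *; set n := Cmod v in Hn Hx1 Hx2 Hx3 Hx4 HE *.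
have Hw : (Cmod (v * p - E) <= A * n)%Re.
  apply: Rle_trans (Cmod_triangle _ _) _; rewrite Cmod_opp Cmod_mult -/n /A.
  have : (K * (n * n) <= K * n)%Re by apply: Rmult_le_compat_l => //; nra.
  lra.
have HAn : (2 * (A + 1) * n < 1)%Re.
  have P : (0 < 2 * (A + 1))%Re by lra.
  by have := Rmult_lt_compat_l _ _ _ P Hx3; rewrite Rinv_r; lra.
have Hw2 : (Cmod (v * p - E) <= 1 / 2)%Re by lra.
have HC := Cexp_sub_bound Hw2.
have -> : g * Cexp (v * p - E) - g - v * (g * p) =
  g * ((Cexp (v * p - E) - RtoC 1 - (v * p - E)) + - E) by ring.
rewrite Cmod_mult.
apply: (Rle_trans _ (M * (n * n))).
  rewrite /M Rmult_assoc; apply: Rmult_le_compat_l => //.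
  apply: Rle_trans (Cmod_triangle _ _) _; rewrite Cmod_opp.
  have := Cmod_ge_0 (v * p - E) => Hw0.
  have : (Cmod (v * p - E) * Cmod (v * p - E) <= (A * n) * (A * n))%Re by exact: Rmult_le_compat.
  lra.
have : ((M + 1) * n <= eps)%Re.
  have P : (0 < M + 1)%Re by lra.
  have := Rmult_lt_compat_l _ _ _ P Hx4.
  have -> : ((M + 1) * (eps / (M + 1)) = eps)%Re by field; lra.
  lra.
nra.
Qed.

(** * Logarithmic derivatives at small [hbar] *)

Lemma at_right0_lt (d : R) : (0 < d)%Re -> at_right 0%Re (fun e => (0 < e < d)%Re).
Proof.
move=> Hd; exists (mkposreal _ Hd) => e /= He He0; split => //.
move: He; rewrite /ball /= /AbsRing_ball /abs /minus /plus /opp /= Ropp_0 Rplus_0_r.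
by move=> He; apply: Rle_lt_trans (Rle_abs _) He.
Qed.

Lemma at_right0_pos : at_right 0%Re (fun e => (0 < e)%Re).
Proof. by apply: filter_imp (at_right0_lt Rlt_0_1) => e []. Qed.

Lemma filterlim_at_right0_id : filterlim (fun e : R => e) (at_right 0%Re) (locally 0%Re).
Proof. exact: filter_le_within. Qed.

Lemma filterlim_at_right0_linear (c : C) :
  filterlim (fun e => RtoC e * c) (at_right 0%Re) (locally (RtoC 0)).
Proof.
rewrite -(Cmult_0_l c); apply: filterlim_Cmult; last exact: filterlim_const.
by apply: filterlim_RtoC; exact: filterlim_at_right0_id.
Qed.

Lemma filterlim_Clog_shift (w : C) (c : R) : slit w ->
  filterlim (fun e => Clog (w + RtoC (2 * e * c))) (at_right 0%Re) (locally (Clog w)).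
Proof.
move=> Hw.
have E0 : w + RtoC 0 * RtoC (2 * c) = w by ring.
have Hs : slit (w + RtoC 0 * RtoC (2 * c)) by rewrite E0.
have [H1 H2] := is_derive_Clog_segment Hs.
have C1 := ex_derive_continuous _ _ (ex_intro _ _ H1).
have C2 := ex_derive_continuous _ _ (ex_intro _ _ H2).
have C1' := filterlim_comp _ _ _ _ _ _ _ _ filterlim_at_right0_id C1.
have C2' := filterlim_comp _ _ _ _ _ _ _ _ filterlim_at_right0_id C2.
apply/filterlim_C => eps He; have He2 : (0 < eps / 2)%Re by lra.
move/filterlim_locally: C1' => /(_ (mkposreal _ He2)) C1'.
move/filterlim_locally: C2' => /(_ (mkposreal _ He2)) C2'.
apply: filter_imp (filter_and _ _ C1' C2') => e.
rewrite E0; have -> : w + RtoC e * RtoC (2 * c) = w + RtoC (2 * e * c) by rewrite !RtoC_mult; ring.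
move=> [G1 G2]; apply: Rle_lt_trans (Cmod_le_parts _) _.
have -> : eps = (eps / 2 + eps / 2)%Re by field.
exact: Rplus_lt_compat G1 G2.
Qed.

(** With p = w/2e + c, scaling gives Clog p + log 2e = Clog (w + 2ec). The expression is therefore
    digamma p - Clog p, which is O(e) by the bound with r = |w|/2e, plus Clog (w + 2ec) - Clog w,
    which tends to 0 by continuity. *)
Lemma digamma_scaled_lim (w : C) (c : R) : slit w ->
  at_right 0%Re (fun e => slit (w / RtoC (2 * e) + RtoC c)) /\
  filterlim (fun e => digamma (w / RtoC (2 * e) + RtoC c) + RtoC (ln (2 * e)) - Clog w)
    (at_right 0%Re) (locally (RtoC 0)).
Proof.
move=> Hw; have [d [Hd Hb]] := slit_lower Hw; have Hw0 := slit_neq_0 Hw.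
have Hdw : (0 < d * Cmod w)%Re by apply: Rmult_lt_0_compat.
have Hc := Rabs_pos c.
(* The first bound gives r = |w|/2e >= 1; the second makes the shift by c cost at most half of the
   lower bound d |w|, so that d/2 remains. *)
set e0 := Rmin (Cmod w / 2) (d * Cmod w / (4 * (Rabs c + 1))).
have He0 : (0 < e0)%Re by apply: Rmin_glb_lt; [lra | apply: Rdiv_lt_0_compat; lra].
have Hlow e : (0 < e < e0)%Re -> (1 <= Cmod w / (2 * e))%Re /\
  forall t, (0 <= t)%Re ->
    (d / 2 * (Cmod w / (2 * e) + t) <= Cmod (w / RtoC (2 * e) + RtoC c + RtoC t))%Re.
  move=> [He1 He2].
  have He3 : (e < Cmod w / 2)%Re by apply: Rlt_le_trans He2 (Rmin_l _ _).
  have He4 : (4 * (Rabs c + 1) * e < d * Cmod w)%Re.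
    have He4 : (e < d * Cmod w / (4 * (Rabs c + 1)))%Re by apply: Rlt_le_trans He2 (Rmin_r _ _).
    have P : (0 < 4 * (Rabs c + 1))%Re by lra.
    have := Rmult_lt_compat_l _ _ _ P He4.
    have -> : (4 * (Rabs c + 1) * (d * Cmod w / (4 * (Rabs c + 1))) = d * Cmod w)%Re by field; lra.
    by [].
  split.
    apply: (Rmult_le_reg_r (2 * e)); first lra.
    by rewrite /Rdiv Rmult_assoc Rinv_l; lra.
  move=> t Ht.
  have He5 : RtoC (2 * e) <> RtoC 0 by move=> /RtoC_inj; lra.
  have -> : w / RtoC (2 * e) + RtoC c + RtoC t =
    (w + RtoC (2 * e * t) + RtoC (2 * e * c)) / RtoC (2 * e).
    by rewrite (RtoC_mult (2 * e)) (RtoC_mult (2 * e) c); field.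
  rewrite Cmod_div // Cmod_R (Rabs_pos_eq (2 * e)); last lra.
  apply: (Rmult_le_reg_r (2 * e)); first lra.
  rewrite /Rdiv (Rmult_assoc (Cmod _)) Rinv_l ?Rmult_1_r; last lra.
  have -> : (d * / 2 * (Cmod w * / (2 * e) + t) * (2 * e) = d / 2 * (Cmod w + 2 * e * t))%Re by field; lra.
  have H2et : (0 <= 2 * e * t)%Re by nra.
  have H1 := Hb _ H2et.
  have := Cmod_triangle (w + RtoC (2 * e * t) + RtoC (2 * e * c)) (- RtoC (2 * e * c)).
  have -> : w + RtoC (2 * e * t) + RtoC (2 * e * c) + - RtoC (2 * e * c) = w + RtoC (2 * e * t) by ring.
  rewrite Cmod_opp Cmod_R Rabs_mult (Rabs_pos_eq (2 * e)); last lra.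
  have : (0 <= d * (2 * e * t))%Re by nra.
  lra.
have Hslit e : (0 < e < e0)%Re -> slit (w / RtoC (2 * e) + RtoC c).
  move=> He; have [H1 H2] := Hlow e He; apply: slit_of_shifts => t Ht.
  by apply: Rlt_le_trans (H2 t Ht); apply: Rmult_lt_0_compat; lra.
split; first exact: filter_imp Hslit (at_right0_lt He0).
have HS : filterlim (fun e => Clog (w + RtoC (2 * e * c)) - Clog w) (at_right 0%Re) (locally (RtoC 0)).
  have -> : RtoC 0 = Clog w - Clog w by ring.
  by apply: filterlim_Cminus; [exact: filterlim_Clog_shift | exact: filterlim_const].
have HT : filterlim (fun e => digamma (w / RtoC (2 * e) + RtoC c) - Clog (w / RtoC (2 * e) + RtoC c))
    (at_right 0%Re) (locally (RtoC 0)).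
  apply: (@filterlim_C_bound _ _ _ _ _ (fun e => e * (32 / (d * d * Cmod w)))%Re).
    apply: filter_imp (at_right0_lt He0) => e He.
    have [H1 H2] := Hlow e He.
    have Hd2 : (0 < d / 2)%Re by lra.
    have [_ H3] := digamma_lim_bound Hd2 H1 H2.
    have -> : forall x : C, x - RtoC 0 = x by move=> x; ring.
    apply: Rle_trans H3 _; apply: Req_le; field; lra.
  have H := filterlim_at_right0_linear (RtoC (32 / (d * d * Cmod w))).
  have HR := filterlim_Re H.
  apply: (filterlim_ext (fun e => Re (RtoC e * RtoC (32 / (d * d * Cmod w))))); last exact: HR.
  by move=> e; rewrite -RtoC_mult re_RtoC.
apply: (filterlim_C_eq (filterlim_Cplus HT HS)); first by rewrite Cplus_0_l.
apply: filter_imp (at_right0_lt He0) => e He.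
have He1 : (0 < 2 * e)%Re by lra.
have := Clog_scale He1 (Hslit e He).
have -> : RtoC (2 * e) * (w / RtoC (2 * e) + RtoC c) = w + RtoC (2 * e * c).
  by rewrite (RtoC_mult (2 * e) c); field; move=> /RtoC_inj; lra.
by move=> ->; ring.
Qed.

(** * Gamma factors with formal poles, and a calculus of scaled logarithmic derivatives *)

Lemma GammaF_neq_0 (eps x : C) : eps <> RtoC 0 -> GammaF eps x <> RtoC 0.
Proof.
move=> He; rewrite /GammaF; case: excluded_middle_informative => H; last by have [] := Gamma_lim H.
by move=> /= E; have := Cinv_r _ He; rewrite E Cmult_0_r => /RtoC_inj; lra.
Qed.

(** The poles stay at distance at least d from x0, so the formal value / eps does not occur near
    x0. *)
Lemma is_derive_GammaF (eps x0 : C) : slit x0 ->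
  @is_derive C_AbsRing C_NormedModule (GammaF eps) x0 (GammaF eps x0 * digamma x0).
Proof.
move=> Hs; have [d [Hd Hb]] := slit_lower_unit Hs.
have E x : (Cmod (x - x0) < d)%Re -> GammaF eps x = Gamma x.
  move=> Hx; rewrite /GammaF; case: excluded_middle_informative => // [[k Hk]].
  have P := pos_INR k; have := Hb _ P.
  have -> : x0 + RtoC (INR k) = - (x - x0) by rewrite Hk; ring.
  by rewrite Cmod_opp; nra.
have E0 : GammaF eps x0 = Gamma x0.
  by apply: E; have -> : x0 - x0 = RtoC 0; [ring | rewrite Cmod_0].
rewrite E0; apply/is_C_derive_spec => r Hr.
have [d' [Hd' H]] := proj1 (is_C_derive_spec _ _ _) (is_derive_Gamma Hs) r Hr.
exists (Rmin d d'); split; first exact: Rmin_glb_lt.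
move=> y Hy; rewrite E0 E; last by apply: Rlt_le_trans Hy (Rmin_l _ _).
by apply: H; apply: Rlt_le_trans Hy (Rmin_r _ _).
Qed.

(** Up to o(1), [g e] is 2 hbar times the logarithmic derivative of [F e] at x, where hbar = e u.
    The function [g] need not converge: a single Gamma factor contributes a multiple of log 2e,
    which disappears only in the total. Writing the derivative as [F e x * d e] turns products into
    sums. *)
Definition scaled_dlog (u : C) (F : R -> C -> C) (x : C) (g : R -> C) : Prop :=
  exists d : R -> C,
    at_right 0%Re (fun e => F e x <> RtoC 0 /\
      @is_derive C_AbsRing C_NormedModule (F e) x (F e x * d e)) /\
    filterlim (fun e => RtoC 2 * (RtoC e * u) * d e - g e) (at_right 0%Re) (locally (RtoC 0)).

Section ScaledDlog.
Variables (u x : C).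
Hypothesis Hu : u <> RtoC 0.
Implicit Types (F G : R -> C -> C) (g : R -> C).

Lemma scaled_dlog_ext F G g k :
  at_right 0%Re (fun e => forall y, F e y = G e y) ->
  at_right 0%Re (fun e => g e = k e) ->
  scaled_dlog u F x g -> scaled_dlog u G x k.
Proof.
move=> HFG Hgk [d [H1 H2]]; exists d; split.
- apply: filter_imp (filter_and _ _ HFG H1) => e [E [N D]]; rewrite -E; split => //.
  exact: (is_derive_ext _ _ _ _ E).
- by apply: (filterlim_C_eq H2) => //; apply: filter_imp Hgk => e ->.
Qed.

Lemma scaled_dlog_const F :
  at_right 0%Re (fun e => F e x <> RtoC 0 /\ forall y, F e y = F e x) ->
  scaled_dlog u F x (fun _ => RtoC 0).
Proof.
move=> H; exists (fun _ => RtoC 0); split.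
- apply: filter_imp H => e [N E]; split => //.
  rewrite Cmult_0_r; apply: (is_derive_ext (fun _ => F e x)) => [y|]; first by rewrite E.
  exact: (@is_derive_const C_AbsRing C_NormedModule).
- apply: (filterlim_ext (fun _ => RtoC 0)); last exact: filterlim_const.
  by move=> e; ring.
Qed.

Lemma scaled_dlog_mul F G g k :
  scaled_dlog u F x g -> scaled_dlog u G x k ->
  scaled_dlog u (fun e y => F e y * G e y) x (fun e => g e + k e).
Proof.
move=> [d [H1 H2]] [d' [H1' H2']]; exists (fun e => d e + d' e); split.
- apply: filter_imp (filter_and _ _ H1 H1') => e [[N D] [N' D']].
  split; first exact: Cmult_neq_0.
  have -> : F e x * G e x * (d e + d' e) = (F e x * d e) * G e x + F e x * (G e x * d' e) by ring.
  exact: is_C_derive_mult.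
- apply: (filterlim_C_eq (filterlim_Cplus H2 H2')); first by rewrite Cplus_0_l.
  by apply: filter_forall => e; ring.
Qed.

Lemma scaled_dlog_inv F g :
  scaled_dlog u F x g -> scaled_dlog u (fun e y => / F e y) x (fun e => - g e).
Proof.
move=> [d [H1 H2]]; exists (fun e => - d e); split.
- apply: filter_imp H1 => e [N D]; split.
    by move=> E; have := Cinv_r _ N; rewrite E Cmult_0_r => /RtoC_inj; lra.
  have -> : / F e x * - d e = (F e x * d e) * - / (F e x * F e x) by field.
  exact: is_C_derive_comp (is_C_derive_inv N) D.
- apply: (filterlim_C_eq (filterlim_Copp H2)); first by rewrite Copp_0.
  by apply: filter_forall => e; ring.
Qed.

Lemma scaled_dlog_div F G g k :
  scaled_dlog u F x g -> scaled_dlog u G x k ->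
  scaled_dlog u (fun e y => F e y / G e y) x (fun e => g e - k e).
Proof. by move=> HF HG; exact: scaled_dlog_mul HF (scaled_dlog_inv HG). Qed.

Lemma scaled_dlog_prod (T : finType) (F : T -> R -> C -> C) (g : T -> R -> C) :
  (forall i, scaled_dlog u (F i) x (g i)) ->
  scaled_dlog u (fun e y => \cprod_(i in T) F i e y) x (fun e => \csum_(i in T) g i e).
Proof.
move=> H; elim: (index_enum T) => [|i r IH].
- apply: scaled_dlog_ext (@scaled_dlog_const (fun _ _ => RtoC 1) _).
  + by apply: filter_forall => e y; rewrite big_nil.
  + by apply: filter_forall => e; rewrite big_nil.
  + by apply: filter_forall => e; split => //; exact: C1_nz.
- apply: scaled_dlog_ext (scaled_dlog_mul (H i) IH).
  + by apply: filter_forall => e y; rewrite big_cons.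
  + by apply: filter_forall => e; rewrite big_cons.
Qed.

Lemma scaled_dlog_list (T : Type) (F : T -> R -> C -> C) (r : list T) :
  (forall w, List.In w r -> scaled_dlog u (F w) x (fun _ => RtoC 0)) ->
  scaled_dlog u (fun e y => List.fold_right Cmult (RtoC 1) (List.map (fun w => F w e y) r)) x
    (fun _ => RtoC 0).
Proof.
elim: r => [|w r IH] H /=.
- by apply: scaled_dlog_const; apply: filter_forall => e; split => //; exact: C1_nz.
- have IH' : scaled_dlog u (fun e y => List.fold_right Cmult (RtoC 1) (List.map (fun w => F w e y) r)) x
    (fun _ => RtoC 0) by apply: IH => v Hv; apply: H; right.
  apply: scaled_dlog_ext (scaled_dlog_mul (H w (or_introl erefl)) IH').
  + exact: filter_forall.
  + by apply: filter_forall => e; rewrite Cplus_0_l.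
Qed.

Lemma ray_neq_0 e : (0 < e)%Re -> RtoC e * u <> RtoC 0.
Proof. by move=> He; apply: Cmult_neq_0 => // /RtoC_inj; lra. Qed.

Lemma ray2_neq_0 e : (0 < e)%Re -> RtoC 2 * (RtoC e * u) <> RtoC 0.
Proof. by move=> He; apply: Cmult_neq_0; [move=> /RtoC_inj; lra | exact: ray_neq_0]. Qed.

Lemma scaled_dlog_Cexp (a : C) (b L : R -> C) :
  scaled_dlog u (fun e y => Cexp ((a * y + b e) / (RtoC 2 * (RtoC e * u)) * L e)) x
    (fun e => a * L e).
Proof.
exists (fun e => a * L e / (RtoC 2 * (RtoC e * u))); split.
- apply: filter_imp at_right0_pos => e He; have He2 := ray2_neq_0 He.
  set hh := RtoC 2 * (RtoC e * u) in He2 *.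
  split; first exact: Cexp_neq_0.
  set a' := a / hh * L e; set b' := b e / hh * L e.
  have E y : (a * y + b e) / hh * L e = a' * y + b' by rewrite /a' /b' /Cdiv; ring.
  rewrite E.
  apply: (is_derive_ext (fun y => Cexp (a' * y + b'))) => [y|]; first by rewrite E.
  have -> : Cexp (a' * x + b') * (a * L e / hh) = a' * Cexp (a' * x + b') by rewrite /a' /Cdiv; ring.
  apply: (@is_C_derive_comp Cexp); [exact: is_C_derive_Cexp | exact: is_C_derive_affine].
- apply: (filterlim_ext_loc (fun _ => RtoC 0)); last exact: filterlim_const.
  apply: filter_imp at_right0_pos => e He; field; split; first exact: Hu.
  by move=> /RtoC_inj; lra.
Qed.

(** The case a = 0 covers factors that do not depend on the variable, in particular those of pairs
    (i, i), which may sit at a pole. Otherwise division by u turns the ray into the positive reals,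
    and the integer k becomes the bounded shift k/2 of the argument. *)
Lemma scaled_dlog_Gamma (eps a b : C) (k : Z) : eps <> RtoC 0 ->
  a = RtoC 0 \/ off_cut u (a * x + b) ->
  scaled_dlog u (fun e y => Gamma2 eps (RtoC e * u) (a * y + b + ZtoC k * (RtoC e * u))) x
    (fun e => a * (Clog ((a * x + b) / u) - RtoC (ln (2 * e)))).
Proof.
move=> Heps [->|Hcut].
  apply: scaled_dlog_ext
    (@scaled_dlog_const (fun e _ => Gamma2 eps (RtoC e * u) (b + ZtoC k * (RtoC e * u))) _).
  - by apply: filter_forall => e y; rewrite Cmult_0_l Cplus_0_l.
  - by apply: filter_forall => e; rewrite Cmult_0_l.
  - by apply: filter_forall => e; split=> //; exact: GammaF_neq_0.
have Hs := off_cut_slit Hu Hcut; set w := (a * x + b) / u in Hs *.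
have [Hsl Hlim] := digamma_scaled_lim (IZR k / 2) Hs.
pose p e := w / RtoC (2 * e) + RtoC (IZR k / 2).
exists (fun e => a / (RtoC 2 * (RtoC e * u)) * digamma (p e)); split.
- apply: filter_imp (filter_and _ _ at_right0_pos Hsl) => e [He Hse].
  have He2 := ray2_neq_0 He; set hh := RtoC 2 * (RtoC e * u) in He2 *.
  have He0 : RtoC e <> RtoC 0 by move=> /RtoC_inj; lra.
  have H20 : RtoC 2 <> RtoC 0 by move=> /RtoC_inj; lra.
  split; first exact: GammaF_neq_0.
  set a' := a / hh; set b' := (b + ZtoC k * (RtoC e * u)) / hh.
  have E y : (a * y + b + ZtoC k * (RtoC e * u)) / hh = a' * y + b' by rewrite /a' /b' /Cdiv; ring.
  have Ep : a' * x + b' = p e.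
    rewrite -E /p /w /hh /ZtoC RtoC_mult RtoC_div; last by lra.
    by field; repeat split.
  rewrite /Gamma2 -/hh E Ep.
  apply: (is_derive_ext (fun y => GammaF eps (a' * y + b'))) => [y|]; first by rewrite E.
  have -> : GammaF eps (p e) * (a' * digamma (p e)) = a' * (GammaF eps (p e) * digamma (p e)) by ring.
  apply: (@is_C_derive_comp (GammaF eps)); last exact: is_C_derive_affine.
  by rewrite Ep; exact: is_derive_GammaF.
- apply: (filterlim_C_eq (filterlim_Cmult (filterlim_const a) Hlim)); first by rewrite Cmult_0_r.
  apply: filter_imp at_right0_pos => e He.
  rewrite /p; field; split; first exact: Hu.
  by move=> /RtoC_inj; lra.
Qed.

(** This is the form of a weight of the insertion. The logarithmic derivative a/(v + e c) stays
    bounded if a is nonzero, and the factor 2 e u then kills it. If a = 0 the limit v may vanish,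
    but then c keeps the weight nonzero for e > 0. *)
Lemma scaled_dlog_affine (a b c : C) :
  (a <> RtoC 0 -> a * x + b <> RtoC 0) ->
  (a * x + b = RtoC 0 -> c <> RtoC 0) ->
  scaled_dlog u (fun e y => a * y + b + RtoC e * c) x (fun _ => RtoC 0).
Proof.
move=> Ha Hc; set v := a * x + b in Ha Hc.
have Hlim : filterlim (fun e => v + RtoC e * c) (at_right 0%Re) (locally v).
  rewrite -{2}(Cplus_0_r v); apply: filterlim_Cplus; first exact: filterlim_const.
  exact: filterlim_at_right0_linear.
have Hnz : at_right 0%Re (fun e => v + RtoC e * c <> RtoC 0).
  case: (Ceq_dec v (RtoC 0)) => [Hv|Hv].
    apply: filter_imp at_right0_pos => e He; rewrite Hv Cplus_0_l; apply: Cmult_neq_0; last exact: Hc.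
    by move=> /RtoC_inj; lra.
  have Hv' := proj1 (Cmod_gt_0 v) Hv.
  apply: filter_imp (proj1 (filterlim_C _ _) Hlim _ Hv') => e He E.
  by move: He; rewrite E; have -> : RtoC 0 - v = - v; [ring | rewrite Cmod_opp; lra].
exists (fun e => a / (v + RtoC e * c)); split.
- apply: filter_imp Hnz => e He; split; first exact: He.
  have -> : (a * x + b + RtoC e * c) * (a / (v + RtoC e * c)) = a by rewrite -/v; field.
  have E y : a * y + b + RtoC e * c = a * y + (b + RtoC e * c) by ring.
  apply: (is_derive_ext (fun y => a * y + (b + RtoC e * c))) => [y|]; first by rewrite E.
  exact: is_C_derive_affine.
- case: (Ceq_dec a (RtoC 0)) => [E|Ha0].
    apply: (filterlim_ext (fun _ => RtoC 0)); last exact: filterlim_const.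
    by move=> e; rewrite E /Cdiv; ring.
  apply: (filterlim_C_eq (filterlim_Cmult (filterlim_at_right0_linear (RtoC 2 * u * a))
    (filterlim_Cinv (Ha Ha0) Hlim))); first by rewrite Cmult_0_l.
  by apply: filter_forall => e; rewrite /Cdiv; ring.
Qed.

(** Complex derivatives are unique, so D must be [F e x * d e]; this translates the condition in
    [saddle_point] into one on [g]. *)
Lemma scaled_dlog_critical F g : scaled_dlog u F x g ->
  (exists D : R -> C,
     at_right 0%Re (fun e => F e x <> RtoC 0 /\
       @is_derive C_AbsRing C_NormedModule (F e) x (D e)) /\
     filterlim (fun e => RtoC 2 * (RtoC e * u) * D e / F e x) (at_right 0%Re) (locally (RtoC 0)))
  <-> filterlim g (at_right 0%Re) (locally (RtoC 0)).
Proof.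
move=> [d [H1 H2]]; split.
- move=> [D [D1 D2]]; apply: (filterlim_C_eq (filterlim_Cminus D2 H2)); first exact: Cplus_opp_r.
  apply: filter_imp (filter_and _ _ H1 D1) => e [[N E1] [_ E2]].
  by rewrite (is_C_derive_unique' E2 E1); field.
- move=> Hg; exists (fun e => F e x * d e); split; first exact: H1.
  apply: (filterlim_C_eq (filterlim_Cplus H2 Hg)); first by rewrite Cplus_0_l.
  apply: filter_imp H1 => e [N _].
  by field.
Qed.

End ScaledDlog.

(** * The integrand *)

Lemma cprod_neq_0 (T : finType) (P : pred T) (F : T -> C) :
  (forall i, F i <> RtoC 0) -> \big[Cmult/RtoC 1]_(i | P i) F i <> RtoC 0.
Proof.
move=> H; apply: (big_ind (fun z => z <> RtoC 0)) => [|x y Hx Hy|i _]; last exact: H.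
- exact: C1_nz.
- exact: Cmult_neq_0.
Qed.

Lemma Cinv_neq_0 (z : C) : z <> RtoC 0 -> / z <> RtoC 0.
Proof. by move=> Hz E; have := Cinv_r _ Hz; rewrite E Cmult_0_r => /RtoC_inj; lra. Qed.

Lemma A_lambda_neq_0 n (lam : n.-tuple box) sigma h (eps hb : C) :
  eps <> RtoC 0 -> A_lambda lam sigma h eps hb <> RtoC 0.
Proof.
move=> He.
have HG x : Gamma2 eps hb x <> RtoC 0 by exact: GammaF_neq_0.
have HF x : fac eps x <> RtoC 0 by rewrite /fac; case: Ceq_dec.
rewrite /A_lambda /A2_lambda /A1bar_lambda /A1_lambda /A1_lambda_num.
repeat first [exact: HG | exact: HF | apply: Cmult_neq_0 | apply: Cinv_neq_0
  | apply: cprod_neq_0 => ?].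
Qed.

(** * Sums with Kronecker deltas and the dependence on one variable *)

Lemma csum_scale (T : finType) (c : C) (F : T -> C) :
  c * (\csum_(i in T) F i) = \csum_(i in T) (c * F i).
Proof. by apply: big_morph => [x y|]; [exact: Cmult_plus_distr_l | exact: Cmult_0_r]. Qed.

Lemma csum_minus (T : finType) (F G : T -> C) :
  \csum_(i in T) (F i - G i) = (\csum_(i in T) F i) - (\csum_(i in T) G i).
Proof.
rewrite big_split /=; congr (_ + _).
by symmetry; apply: big_morph => [x y|]; [exact: Copp_plus_distr | exact: Copp_0].
Qed.

Definition delta n (i k : 'I_n) : C := if k == i then RtoC 1 else RtoC 0.

Lemma csum_delta n (i : 'I_n) (F : 'I_n -> C) : \csum_(k in 'I_n) (delta i k * F k) = F i.
Proof.
rewrite (bigD1 i) //= /delta eqxx Cmult_1_l big1 ?Cplus_0_r // => k /negbTE ->.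
exact: Cmult_0_l.
Qed.

(** The difference of deltas is the derivative of s_k - s_l in s_i, so a sum over ordered pairs
    collapses to row i minus column i; the pair (i, i) cancels. *)
Lemma csum_delta_pairs n (i : 'I_n) (q : 'I_n -> 'I_n -> C) :
  \csum_(k in 'I_n) \csum_(l in 'I_n) ((delta i k - delta i l) * q k l)
  = \csum_(j in 'I_n) (q i j - q j i).
Proof.
transitivity (\csum_(k in 'I_n) (delta i k * (\csum_(l in 'I_n) q k l) - q k i)).
  apply: eq_bigr => k _; rewrite csum_scale -[X in _ - X](csum_delta i) -csum_minus.
  by apply: eq_bigr => l _; ring.
by rewrite !csum_minus csum_delta.
Qed.

Lemma Cexp_csum (T : finType) (F : T -> C) :
  Cexp (\csum_(i in T) F i) = \cprod_(i in T) Cexp (F i).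
Proof. by apply: big_morph; [exact: Cexp_add | exact: Cexp_0]. Qed.

Lemma updE n (s : 'I_n -> C) i x k : upd s i x k = delta i k * x + (s k - delta i k * s i).
Proof. by rewrite /upd /delta; case: eqP => [->|_]; ring. Qed.

Lemma upd_id n (s : 'I_n -> C) i : upd s i (s i) = s.
Proof. by apply: functional_extensionality => k; rewrite updE; ring. Qed.

(** Brings a weight to the form of [scaled_dlog_affine]. The Chern roots are 2 hbar_box - s, whence
    the slope -wt_root, and c_1(q) = -hbar gives the last sign. *)
Lemma wt_c1_upd n (lam : n.-tuple box) (h : 'I_3 -> C) hb (s : 'I_n -> C) i x (w : weight n) :
  wt_c1 h hb (chern_roots lam h (upd s i x)) w =
  - ZtoC (wt_root w i) * x
  + (ZtoC (wt_root w i) * s i + wt_c1 h (RtoC 0) (chern_roots lam h s) w)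
  + hb * - ZtoC (wt_q w).
Proof.
rewrite /wt_c1.
have -> : \csum_(k in 'I_n) (ZtoC (wt_root w k) * chern_roots lam h (upd s i x) k) =
  (\csum_(k in 'I_n) (ZtoC (wt_root w k) * chern_roots lam h s k))
  - ZtoC (wt_root w i) * (x - s i).
  rewrite -(csum_delta i (fun k => ZtoC (wt_root w k) * (x - s i))) -csum_minus.
  by apply: eq_bigr => k _; rewrite /chern_roots updE; ring.
by ring.
Qed.

Section Integrand.
Variables (n : nat) (lam : n.-tuple box) (sigma : 'I_3 -> Z) (h : 'I_3 -> C) (tau : Kclass n).
Variables (eps u : C) (s : 'I_n -> C).
Hypotheses (Heps : eps <> RtoC 0) (Hu : u <> RtoC 0) (Hs : regular_point lam h tau u s).

Lemma scaled_dlog_K_euler (i : 'I_n) :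
  scaled_dlog u (fun e x => K_euler h (RtoC e * u) tau (chern_roots lam h (upd s i x))) (s i)
    (fun _ => RtoC 0).
Proof.
have H w : List.In w (K_pos tau) \/ List.In w (K_neg tau) ->
  scaled_dlog u (fun e x => wt_c1 h (RtoC e * u) (chern_roots lam h (upd s i x)) w) (s i)
    (fun _ => RtoC 0).
  move=> Hw; have [_ [_ [_ Hr]]] := Hs; have [[hb Hhb] Hr2] := Hr w Hw.
  have Hv : - ZtoC (wt_root w i) * s i
    + (ZtoC (wt_root w i) * s i + wt_c1 h (RtoC 0) (chern_roots lam h s) w)
    = wt_c1 h (RtoC 0) (chern_roots lam h s) w by ring.
  apply: (scaled_dlog_ext _ _ (@scaled_dlog_affine u (s i)
    (- ZtoC (wt_root w i))
    (ZtoC (wt_root w i) * s i + wt_c1 h (RtoC 0) (chern_roots lam h s) w)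
    (u * - ZtoC (wt_q w)) _ _)).
  - by apply: filter_forall => e y; rewrite wt_c1_upd Cmult_assoc.
  - exact: filter_forall.
  - rewrite Hv => Ha; apply: Hr2; exists i => E; apply: Ha.
    by rewrite E /ZtoC Copp_0.
  (* If both the value at hbar = 0 and the coefficient of hbar vanished, the weight would vanish for
     every hbar, against regularity. *)
  - rewrite Hv => E0 Hc; apply: Hhb.
    rewrite -(upd_id s i) wt_c1_upd Hv E0 Cplus_0_l.
    have -> : - ZtoC (wt_q w) = / u * (u * - ZtoC (wt_q w)) by field.
    by rewrite Hc; ring.
apply: (scaled_dlog_ext _ _ (scaled_dlog_div
  (scaled_dlog_list (r := K_pos tau) (fun w Hw => H w (or_introl Hw)))
  (scaled_dlog_list (r := K_neg tau) (fun w Hw => H w (or_intror Hw))))).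
- exact: filter_forall.
- by apply: filter_forall => e; ring.
Qed.

Let logu (x : C) : C := Clog (x / u).

Lemma scaled_dlog_Gamma_diff (i k l : 'I_n) (c : C) (m : Z) :
  (k != l -> off_cut u (s k - s l + c)) ->
  scaled_dlog u
    (fun e x => Gamma2 eps (RtoC e * u) (upd s i x k - upd s i x l + c + ZtoC m * (RtoC e * u)))
    (s i)
    (fun e => (delta i k - delta i l) * (logu (s k - s l + c) - RtoC (ln (2 * e)))).
Proof.
move=> Hc; set b := s k - s l + c - (delta i k - delta i l) * s i.
have E : (delta i k - delta i l) * s i + b = s k - s l + c by rewrite /b; ring.
apply: (scaled_dlog_ext _ _ (scaled_dlog_Gamma Hu m Heps
  (a := delta i k - delta i l) (b := b) (x := s i) _)).
- by apply: filter_forall => e y; congr Gamma2; rewrite !updE /b; ring.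
- by apply: filter_forall => e; rewrite E.
- rewrite E; case: (eqVneq k l) => [->|Hkl]; [left; ring | right; exact: Hc].
Qed.

(** The part of an ordered pair of boxes that is finite as e tends to 0: three numerator Gammas
    minus the denominator. For k = l it evaluates [Clog] at 0, which is harmless because only
    differences with the transposed pair occur. *)
Definition pair_phase (k l : 'I_n) : C :=
  (\csum_(a in 'I_3) Clog ((s k - s l + h a) / u)) - Clog ((s k - s l) / u).

(* [L i + saddle_phase i - log 2e] is the derivative in [s i] of the function S
   for which the integrand behaves as exp (S / 2 hbar). *)
Definition saddle_phase (i : 'I_n) : C :=
  Clog (s i / u) + \csum_(j in 'I_n) (pair_phase i j - pair_phase j i).

Lemma scaled_dlog_integrand (L : R -> 'I_n -> C) (i : 'I_n) :
  scaled_dlog u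
    (fun e x => integrand lam sigma h tau eps (RtoC e * u) (L e) (upd s i x)) (s i)
    (fun e => L e i - RtoC (ln (2 * e)) + saddle_phase i).
Proof.
have [Hs1 [Hs2 [Hs3 _]]] := Hs.
have HA : scaled_dlog u (fun e _ => A_lambda lam sigma h eps (RtoC e * u)) (s i) (fun _ => RtoC 0).
  by apply: scaled_dlog_const; apply: filter_forall => e; split => //; exact: A_lambda_neq_0.
have H1 k : scaled_dlog u (fun e x =>
    Cexp ((upd s i x k - h_box h (tnth lam k) - sigma_box sigma (tnth lam k) * (RtoC e * u))
          / (RtoC 2 * (RtoC e * u)) * L e k) * Gamma2 eps (RtoC e * u) (upd s i x k)) (s i)
    (fun e => delta i k * (L e k + (logu (s k) - RtoC (ln (2 * e))))).
  apply: (scaled_dlog_ext _ _ (scaled_dlog_mul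
    (scaled_dlog_Cexp (s i) Hu (delta i k)
      (fun e => s k - delta i k * s i - h_box h (tnth lam k)
                - sigma_box sigma (tnth lam k) * (RtoC e * u)) (fun e => L e k))
    (scaled_dlog_Gamma Hu 0%Z Heps (a := delta i k) (b := s k - delta i k * s i) (x := s i) _))).
  - apply: filter_forall => e y; rewrite updE; congr (_ * _); last by congr Gamma2; rewrite /ZtoC; ring.
    by congr (Cexp (_ / _ * _)); ring.
  - apply: filter_forall => e.
    have -> : delta i k * s i + (s k - delta i k * s i) = s k by ring.
    by rewrite /logu; ring.
  - right; have -> : delta i k * s i + (s k - delta i k * s i) = s k by ring.
    exact: Hs1.
have H2 k l := scaled_dlog_div
  (scaled_dlog_prod (fun a => @scaled_dlog_Gamma_diff i k l (h a) (sigma a) (@Hs3 a k l)))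
  (@scaled_dlog_Gamma_diff i k l (RtoC 0) 0%Z
     (fun Hkl => eq_ind_r (off_cut u) (Hs2 k l Hkl) (Cplus_0_r _))).
have := scaled_dlog_mul (scaled_dlog_mul (scaled_dlog_mul HA (scaled_dlog_K_euler i))
  (scaled_dlog_prod H1)) (scaled_dlog_prod (fun k => scaled_dlog_prod (fun l => H2 k l))).
apply: scaled_dlog_ext.
- apply: filter_forall => e y; rewrite /integrand; congr (_ * _).
  apply: eq_bigr => k _; apply: eq_bigr => l _; congr (_ / _); congr Gamma2.
  by rewrite /ZtoC; ring.
- apply: filter_forall => e.
  set lam2 := RtoC (ln (2 * e)).
  rewrite csum_delta.
  (* Three terms log 2e from the numerators minus one from the denominator leave two per pair. They
     are symmetric in k and l and drop out of [q i j - q j i]. *)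
  pose q k l := pair_phase k l - RtoC 2 * lam2.
  have -> : \csum_(k in 'I_n) \csum_(l in 'I_n)
      ((\csum_(a in 'I_3) ((delta i k - delta i l) * (logu (s k - s l + h a) - lam2)))
       - (delta i k - delta i l) * (logu (s k - s l + RtoC 0) - lam2)) =
    \csum_(k in 'I_n) \csum_(l in 'I_n) ((delta i k - delta i l) * q k l).
    apply: eq_bigr => k _; apply: eq_bigr => l _; rewrite -csum_scale csum_minus /q /pair_phase.
    rewrite Cplus_0_r /logu !big_ord_recr !big_ord0 /=; ring.
  rewrite csum_delta_pairs.
  have -> : \csum_(j in 'I_n) (q i j - q j i) = \csum_(j in 'I_n) (pair_phase i j - pair_phase j i).
    by apply: eq_bigr => j _; rewrite /q; ring.
  by rewrite /saddle_phase /logu; ring.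
Qed.

(** Exchanging i and j changes s_i - s_j + h_a into -(s_i - s_j - h_a). The three signs from the
    numerators and the one from the denominator multiply to 1, and the powers of u cancel between
    the two phases. *)
Lemma Cexp_pair_phase (i j : 'I_n) : j != i ->
  Cexp (- (pair_phase i j - pair_phase j i)) =
  \cprod_(a in 'I_3) ((s i - s j - h a) / (s i - s j + h a)).
Proof.
move=> Hji; have Hij : i != j by rewrite eq_sym.
have [_ [Hs2 [Hs3 _]]] := Hs.
have H0 x : off_cut u x -> x <> RtoC 0.
  by move=> H E; apply: (H 0%Re (Rle_refl 0)); rewrite E; ring.
have Hlog x : off_cut u x -> Cexp (Clog (x / u)) = x / u.
  by move=> H; apply: Cexp_Clog; exact: off_cut_slit.
have X a := Hs3 a i j Hij; have Y a := Hs3 a j i Hji.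
have X0 := Hs2 i j Hij; have Y0 := Hs2 j i Hji.
have X' a := H0 _ (X a); have Y' a := H0 _ (Y a).
have X0' := H0 _ X0; have Y0' := H0 _ Y0.
rewrite /pair_phase !big_ord_recr !big_ord0 /=.
rewrite ?Cexp_opp ?Cexp_add ?Cexp_opp ?Cexp_add ?Cexp_opp ?Cexp_0 !Hlog //.
have EY a : s j - s i + h a = - (s i - s j - h a) by ring.
have EY0 : s j - s i = - (s i - s j) by ring.
have Z' a : s i - s j - h a <> RtoC 0.
  by move=> E; apply: (Y' a); rewrite EY E Copp_0.
rewrite !EY EY0.
move: (X' ord_max) (Z' ord_max) (X' (widen_ord (leqnSn 2) ord_max))
  (Z' (widen_ord (leqnSn 2) ord_max))
  (X' (widen_ord (leqnSn 2) (widen_ord (leqnSn 1) ord_max)))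
  (Z' (widen_ord (leqnSn 2) (widen_ord (leqnSn 1) ord_max))).
move: (h ord_max) (h (widen_ord (leqnSn 2) ord_max))
  (h (widen_ord (leqnSn 2) (widen_ord (leqnSn 1) ord_max))) X0' => b2 b1 b0.
move: (s i - s j) => w W0 P1 P2 P3 P4 P5 P6.
have [Q1 [Q2 Q3]] : - (w - b0) <> RtoC 0 /\ - (w - b1) <> RtoC 0 /\ - (w - b2) <> RtoC 0.
  have N z : z <> RtoC 0 -> - z <> RtoC 0.
    move=> Hz E; apply: Hz; have -> : z = - - z by ring.
    by rewrite E Copp_0.
  by split; [|split]; apply: N.
by field; repeat split.
Qed.

(** The single factor u comes from Log (s_i/u), the only logarithm not paired with another one. *)
Lemma Cexp_saddle_phase (i : 'I_n) :
  Cexp (- saddle_phase i) =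
  u * (/ s i * \cprod_(a in 'I_3) \cprod_(j in 'I_n | j != i)
         ((s i - s j - h a) / (s i - s j + h a))).
Proof.
have Hsi : off_cut u (s i) by case: Hs.
have Hsi0 : s i <> RtoC 0 by move=> E; apply: (Hsi 0%Re (Rle_refl 0)); rewrite E; ring.
have E : \cprod_(j in 'I_n) Cexp (- (pair_phase i j - pair_phase j i)) =
  \cprod_(a in 'I_3) \cprod_(j in 'I_n | j != i) ((s i - s j - h a) / (s i - s j + h a)).
  rewrite exchange_big /= (bigD1 i) //=.
  have -> : - (pair_phase i i - pair_phase i i) = RtoC 0 by ring.
  by rewrite Cexp_0 Cmult_1_l; apply: eq_bigr => j; exact: Cexp_pair_phase.
have -> : - saddle_phase i =
  - Clog (s i / u) + \csum_(j in 'I_n) (- (pair_phase i j - pair_phase j i)).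
  have -> : \csum_(j in 'I_n) (- (pair_phase i j - pair_phase j i)) =
    - \csum_(j in 'I_n) (pair_phase i j - pair_phase j i).
    by symmetry; apply: big_morph => [x y|]; [exact: Copp_plus_distr | exact: Copp_0].
  by rewrite /saddle_phase; ring.
rewrite Cexp_add Cexp_csum E Cexp_opp Cexp_Clog; last exact: off_cut_slit.
by field.
Qed.

End Integrand.

(** * From the vanishing of the scaled logarithmic derivatives to the Bethe equations and back *)

Lemma continuous_ln_scaled (e : R) (c : C) : (0 < e)%Re ->
  continuous (fun e' : R => RtoC (ln (2 * e')) - c) e.
Proof.
move=> He; have H : continuous (fun e' : R => ln (2 * e')) e.
  by apply: ex_derive_continuous; auto_derive; lra.
exact: (filterlim_Cminus (filterlim_RtoC H) (filterlim_const c)).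
Qed.

Theorem theorem1p5 (n : nat) (lam : n.-tuple box) (hlam : is_plane_partition lam)
  (sigma : 'I_3 -> Z)
  (hsigma : (sigma (inord 0) + sigma (inord 1) + sigma (inord 2) = 2)%Z)
  (h : 'I_3 -> C)
  (hCY : (h (inord 0) + h (inord 1) + h (inord 2))%C = RtoC 0)
  (tau : Kclass n) (eps : C) (heps : eps <> RtoC 0)
  (zbar : C) (z : C -> C)
  (hz : forall hb : C, hb <> RtoC 0 -> zbar = (z hb / (RtoC 2 * hb) ^ 2)%C)
  (u : C) (hu : u <> RtoC 0)
  (s : 'I_n -> C) (hs : regular_point lam h tau u s) :
  saddle_point lam sigma h tau eps z u s
  <->
  (forall i : 'I_n,
     zbar = (/ s i * \cprod_(a in 'I_3) \cprod_(j in 'I_n | j != i)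
               ((s i - s j - h a) / (s i - s j + h a)))%C).
Proof.
(* One factor 2 hbar = 2 e u survives the normalization of z: its part 2e matches the uncancelled
   log 2e of Gamma(s_i), its direction u the factor in [Cexp_saddle_phase]. *)
have Hz e : (0 < e)%Re ->
    z (RtoC e * u) / (RtoC 2 * (RtoC e * u)) = RtoC (2 * e) * (u * zbar).
  move=> He; have He0 := ray_neq_0 hu He.
  have He' : RtoC e <> RtoC 0 by move=> /RtoC_inj; lra.
  have H2 : RtoC 2 <> RtoC 0 by move=> /RtoC_inj; lra.
  by rewrite (hz _ He0) RtoC_mult; field; repeat split.
have Hln e : (0 < e)%Re -> Cexp (RtoC (ln (2 * e))) = RtoC (2 * e).
  by move=> He; rewrite Cexp_R exp_ln //; lra.
have Hiff i : (zbar = / s i * \cprod_(a in 'I_3) \cprod_(j in 'I_n | j != i)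
               ((s i - s j - h a) / (s i - s j + h a))) <->
    Cexp (- saddle_phase h u s i) = u * zbar.
  rewrite (Cexp_saddle_phase hu hs); split=> [<- //|E].
  have := f_equal (Cmult (/ u)) E; rewrite !Cmult_assoc Cinv_l // !Cmult_1_l.
  by move=> ->.
have crit L i := scaled_dlog_critical (scaled_dlog_integrand sigma heps hu hs L i).
split.
- move=> [L [HL HD]] i; apply/Hiff.
  have Hg : filterlim (fun e => L e i - RtoC (ln (2 * e)) + saddle_phase h u s i)
      (at_right 0%Re) (locally (RtoC 0)).
    apply/(crit L i); have [D HDi] := HD i; exists D.
    by rewrite upd_id.
  (* For e > 0, [Cexp (f e)] equals u zbar whatever branch [L] follows, while its limit is exp of
     minus the phase; uniqueness of limits equates the two. *)
  pose f e := L e i - RtoC (ln (2 * e)) + saddle_phase h u s i - saddle_phase h u s i.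
  have H1 : filterlim (fun e => Cexp (f e)) (at_right 0%Re) (locally (Cexp (- saddle_phase h u s i))).
    apply: filterlim_Cexp; rewrite -[X in locally X]Cplus_0_l.
    exact: filterlim_Cminus Hg (filterlim_const _).
  suff H2 : filterlim (fun e => Cexp (f e)) (at_right 0%Re) (locally (u * zbar)).
    exact: (@filterlim_C_unique R (at_right 0%Re) (fun e => Cexp (f e)) _ _ _ H1 H2).
  apply: (filterlim_C_eq (filterlim_const (u * zbar))) => //.
  apply: filter_imp at_right0_pos => e He; have [_ HLe] := HL i e He; rewrite /f.
  have -> : L e i - RtoC (ln (2 * e)) + saddle_phase h u s i - saddle_phase h u s i =
    L e i + - RtoC (ln (2 * e)) by ring.
  rewrite Cexp_add Cexp_opp HLe Hz // Hln //; field.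
  by move=> /RtoC_inj; lra.
- move=> H; exists (fun e i => RtoC (ln (2 * e)) - saddle_phase h u s i); split.
  + move=> i e He; split; first exact: continuous_ln_scaled.
    rewrite Hz // /Cminus Cexp_add Hln //; congr (_ * _).
    by apply/Hiff.
  + move=> i; have := proj2 (crit (fun e i => RtoC (ln (2 * e)) - saddle_phase h u s i) i).
    rewrite upd_id; apply.
    apply: (filterlim_C_eq (filterlim_const (RtoC 0))) => //.
    by apply: filter_forall => e; ring.
Qed.
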